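(* Let $\mathcal{S}\subset B(E)$ be an operator system. Then $\mathrm{UEB}(\mathcal{S},B(H))$ equals the $C^*$-convex hull of its $C^*$-extreme points.
   Context: Throughout $E=\mathbb{C}^d$ and $H=\mathbb{C}^n$. $B(L)$ denotes the bounded linear operators on a Hilbert space $L$, $M_k$ the complex $k\times k$ matrices, and a superscript $+$ the positive (semidefinite) elements. An operator system $\mathcal{S}\subset B(E)$ is a self-adjoint linear subspace containing $I_E$. A linear map $\Phi:\mathcal{S}\to B(H)$ is unital if $\Phi(I_E)=I_H$, and entanglement breaking (EB) if for every $k\in\mathbb{N}$ and every $X\in (M_k\otimes\mathcal{S})^+$ (the elements of $M_k\otimes\mathcal{S}\subset B(\mathbb{C}^k\otimes E)$ that are positive operators), one has $(\mathrm{id}_{M_k}\otimes\Phi)(X)\in M_k^+\otimes B(H)^+ := \{\sum_{m=1}^{\ell}A_m\otimes B_m : \ell\in\mathbb{N},\ A_m\in M_k^+,\ B_m\in B(H)^+\}$. UEB means unital and EB; $\mathrm{UEB}(\mathcal{S},B(H))$ is the set of all UEB maps $\mathcal{S}\to B(H)$. $\Phi$ is a $C^*$-convex combination of $\Phi_1,\dots,\Phi_k\in\mathrm{UEB}(\mathcal{S},B(H))$ if there are $T_1,\dots,T_k\in B(H)$ with $\sum_iT_i^*T_i=I_H$ and $\Phi(X)=\sum_iT_i^*\Phi_i(X)T_i$ for all $X\in\mathcal{S}$. It is proper if all $T_i$ are invertible. A proper $C^*$-convex combination is trivial if each $\Phi_i$ is unitarily equivalent to $\Phi$, i.e. there are unitaries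 $U_i\in B(H)$ with $\Phi_i(X)=U_i^*\Phi(X)U_i$ for all $X\in\mathcal{S}$. $\Phi\in\mathrm{UEB}(\mathcal{S},B(H))$ is a $C^*$-extreme point of $\mathrm{UEB}(\mathcal{S},B(H))$ if every representation of $\Phi$ as a proper $C^*$-convex combination of elements of $\mathrm{UEB}(\mathcal{S},B(H))$ is trivial. The $C^*$-convex hull of a subset of $\mathrm{UEB}(\mathcal{S},B(H))$ is the set of all $C^*$-convex combinations of (finitely many) of its elements. *)

(* Defs.v *)
From mathcomp Require Import all_boot all_order all_algebra.
From mathcomp Require Import spectral sesquilinear.
From mathcomp Require mxtens.
From mathcomp Require Import complex.
From mathcomp Require Import classical_sets reals.
Set Implicit Arguments.
Unset Strict Implicit.
Unset Printing Implicit Defensive.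
Import Order.TTheory GRing.Theory Num.Theory.
Local Open Scope ring_scope.
Local Open Scope sesquilinear_scope.
Local Open Scope classical_set_scope.

Section Defs.
Variable C : numClosedFieldType.

(* In the order of C, [0 <= z] says that z is real and nonnegative. *)
Definition psdmx m (A : 'M[C]_m) : Prop :=
  forall v : 'cV[C]_m, 0 <= (v^t* *m A *m v) 0 0.

Definition operator_system d (S : {vspace 'M[C]_d}) : Prop :=
  1%:M \in S /\ forall A, A \in S -> A^t* \in S.

(* An element of M_k (x) V is encoded by its k x k array X of coefficients,
   i.e. X stands for \sum_(i, j) e_ij (x) X i j. Then [ampliation f X] is
   (id (x) f)(X), viewed as an operator on C^k (x) C^m; with f the inclusion
   of V in 'M_m it is the operator X itself. *)
Definition ampliation k m (V : Type) (f : V -> 'M[C]_m) (X : 'M[V]_k)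
    : 'M[C]_(k * m) :=
  \sum_(i < k) \sum_(j < k) mxtens.tensmx (delta_mx i j) (f (X i j)).

(* Membership in M_k^+ (x) M_m^+. *)
Definition separable k m (Y : 'M[C]_(k * m)) : Prop :=
  exists (l : nat) (A : 'I_l -> 'M[C]_k) (B : 'I_l -> 'M[C]_m),
    (forall i, psdmx (A i) /\ psdmx (B i)) /\
    Y = \sum_(i < l) mxtens.tensmx (A i) (B i).

Section Maps.
Variables (d : nat) (S : {vspace 'M[C]_d}) (n : nat).
Notation maps := 'Hom(subvs_of S, 'M[C]_n).

Definition unital (Phi : maps) : Prop :=
  forall X : subvs_of S, vsval X = 1%:M -> Phi X = 1%:M.

Definition entanglement_breaking (Phi : maps) : Prop :=
  forall (k : nat) (X : 'M[subvs_of S]_k),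
    psdmx (ampliation vsval X) -> separable (ampliation Phi X).

Definition UEB : set maps :=
  [set Phi | unital Phi /\ entanglement_breaking Phi].

Definition cstar_combination (k : nat) (T : 'I_k -> 'M[C]_n)
    (Psi : 'I_k -> maps) (Phi : maps) : Prop :=
  \sum_(i < k) (T i)^t* *m T i = 1%:M /\
  forall X, Phi X = \sum_(i < k) (T i)^t* *m Psi i X *m T i.

Definition unitarily_equivalent (Psi Phi : maps) : Prop :=
  exists2 U : 'M[C]_n, U \is unitarymx & forall X, Psi X = U^t* *m Phi X *m U.

Definition cstar_extreme : set maps :=
  [set Phi | UEB Phi /\
    forall (k : nat) (T : 'I_k -> 'M[C]_n) (Psi : 'I_k -> maps),
      (forall i, UEB (Psi i)) -> (forall i, T i \in unitmx) ->
      cstar_combination T Psi Phi ->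
      forall i, unitarily_equivalent (Psi i) Phi].

Definition cstar_hull (F : set maps) : set maps :=
  [set Phi | exists (k : nat) (T : 'I_k -> 'M[C]_n) (Psi : 'I_k -> maps),
    (forall i, F (Psi i)) /\ cstar_combination T Psi Phi].

End Maps.
End Defs.

Arguments UEB {C d} S n.
Arguments cstar_extreme {C d} S n.

(* Main.v *)
Require Import Defs.
From mathcomp Require Import all_boot all_order all_algebra.
From mathcomp Require Import spectral sesquilinear.
From mathcomp Require mxtens.
From mathcomp Require Import complex classical_sets boolp filter reals.
From mathcomp Require Import ring.
Set Implicit Arguments.
Unset Strict Implicit.
Unset Printing Implicit Defensive.
Import Order.TTheory GRing.Theory Num.Theory.
Local Open Scope ring_scope.
Local Open Scope sesquilinear_scope.

(** One inclusion only says that entanglement breaking (EB) maps are stable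
    under sums and under [compress g : Phi |-> g^* Phi g]. For the other one,
    consider for each [n] the convex cone of all EB maps from [S] to the
    [n x n] matrices, unital or not, and call [pure] the elements that span its
    extreme rays.

    On a general operator system an EB map need not be a sum of products of a
    positive functional and a positive matrix: the inclusion of the span of
    [1], [E_12], [E_21] into the 2 x 2 matrices is EB but not of that form. So
    pure maps into matrices of size larger than one are unavoidable, and the
    proof treats the cones for all [n] together.

    The cone is closed along rays (complex_max_multiple). This comes down to
    the same property of the cone of separable matrices, which holds because
    the number of summands (Caratheodory) and their size can be bounded.
    Minkowski's argument then writes every EB map as a finite sum of pure ones
    (eb_sum_pure), and a pure map is [compress g phi] for a unital pure map
    [phi] of dimension at most [n] (pure_normalize). It remains to see that a
    unital pure [phi] of dimension [m <= n] is a compression of a C*-extreme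
    map of dimension [n] (pure_compress_cext):
    - If [m = n], then [phi] itself is C*-extreme, because every summand of it
      is a multiple of it (pure_cext).
    - If [m < n] and [phi] is a corner of some larger EB map in a way that is
      not a direct sum, decompose this larger map into pure summands. One of
      them, normalized, is a unital pure dilation of [phi] of dimension
      [m + 1] (pure_dilation), and one continues with it.
    - If [m < n] and there is no such dilation, then [phi (+) psi] is
      C*-extreme for every C*-extreme [psi] of dimension [n - m] (cext_dsum),
      and such [psi] exist by induction on [n].
    Hence [Phi], a sum of maps [compress g_i phi_i], is a sum of maps
    [compress T_i Psi_i] with [Psi_i] C*-extreme, and the [T_i^* T_i] sum to
    [1] because [Phi] and all [Psi_i] are unital. C*-extremality is checked
    throughout by a criterion about single summands in the cone
    (cext_extreme). *)

(** * Positive semidefinite matrices *)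

Section Adjoint.
Variable C : numClosedFieldType.

Lemma adjmxE m n (A : 'M[C]_(m, n)) i j : (A^t*) i j = (A j i)^*.
Proof. by rewrite !mxE. Qed.

Lemma adjmxM m n p (A : 'M[C]_(m, n)) (B : 'M_(n, p)) :
  (A *m B)^t* = B^t* *m A^t*.
Proof. by rewrite trmx_mul map_mxM. Qed.

Lemma adjmxD m n (A B : 'M[C]_(m, n)) : (A + B)^t* = A^t* + B^t*.
Proof. by rewrite linearD /= map_mxD. Qed.

Lemma adjmxN m n (A : 'M[C]_(m, n)) : (- A)^t* = - A^t*.
Proof. by rewrite linearN /= map_mxN. Qed.

Lemma adjmxZ m n c (A : 'M[C]_(m, n)) : (c *: A)^t* = c^* *: A^t*.
Proof. by rewrite linearZ /= map_mxZ. Qed.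

Lemma adjmx0 m n : (0 : 'M[C]_(m, n))^t* = 0.
Proof. by rewrite trmx0 map_mx0. Qed.

Lemma adjmx1 n : (1%:M : 'M[C]_n)^t* = 1%:M.
Proof. by rewrite trmx1 map_mx1. Qed.

Lemma adjmx_unit n (A : 'M[C]_n) : (A^t* \in unitmx) = (A \in unitmx).
Proof. by rewrite map_unitmx unitmx_tr. Qed.

Lemma adjmx_sum m n (I : Type) (r : seq I) (P : pred I)
    (F : I -> 'M[C]_(m, n)) :
  (\sum_(i <- r | P i) F i)^t* = \sum_(i <- r | P i) (F i)^t*.
Proof. exact: (big_morph (fun A => A^t*) (@adjmxD m n) (adjmx0 m n)). Qed.

Lemma adjmx_scalar n (c : C) : (c%:M : 'M_n)^t* = (c^*)%:M.
Proof. by rewrite -[c%:M]scalemx1 adjmxZ adjmx1 scalemx1. Qed.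

Lemma adjmx_quad m n p (A : 'M[C]_(m, n)) (M : 'M_m) (B : 'M_(m, p)) :
  (A^t* *m M *m B)^t* = B^t* *m M^t* *m A.
Proof. by rewrite !adjmxM trmxCK mulmxA. Qed.

Lemma quadD m n (A : 'M[C]_m) (w u : 'M_(m, n)) :
  w^t* *m A *m u = 0 -> u^t* *m A *m w = 0 ->
  (w + u)^t* *m A *m (w + u) = w^t* *m A *m w + u^t* *m A *m u.
Proof.
by move=> wu uw; rewrite adjmxD !mulmxDl !mulmxDr wu uw addr0 add0r.
Qed.

Lemma adjmx_tens m n p q (A : 'M[C]_(m, n)) (B : 'M[C]_(p, q)) :
  (mxtens.tensmx A B)^t* = mxtens.tensmx (A^t*) (B^t*).
Proof. by rewrite mxtens.trmx_tens mxtens.map_mxT. Qed.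

Lemma gram_eq0 m n (T : 'M[C]_(m, n)) : T^t* *m T = 0 -> T = 0.
Proof.
move=> T0; apply/matrixP => i j; rewrite mxE.
have /matrixP/(_ j j) := T0; rewrite !mxE => /eqP.
rewrite psumr_eq0; last by move=> k _; rewrite adjmxE mulrC mul_conjC_ge0.
move=> /allP/(_ i (mem_index_enum _)) /=.
by rewrite adjmxE mulrC mul_conjC_eq0 => /eqP.
Qed.

Lemma psdmx_gram m n (T : 'M[C]_(m, n)) : psdmx (T^t* *m T).
Proof.
move=> v; rewrite mulmxA -adjmxM -mulmxA mxE sumr_ge0 // => k _.
by rewrite adjmxE mulrC mul_conjC_ge0.
Qed.

Lemma psdmx0 n : psdmx (0 : 'M[C]_n).
Proof. by move=> v; rewrite mulmx0 mul0mx mxE. Qed.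

Lemma psdmx1 n : psdmx (1%:M : 'M[C]_n).
Proof. by rewrite -[1%:M]mulmx1 -{1}adjmx1; apply: psdmx_gram. Qed.

Lemma psdmxD n (A B : 'M[C]_n) : psdmx A -> psdmx B -> psdmx (A + B).
Proof. by move=> pA pB v; rewrite mulmxDr mulmxDl mxE addr_ge0. Qed.

Lemma psdmxZ n c (A : 'M[C]_n) : 0 <= c -> psdmx A -> psdmx (c *: A).
Proof. by move=> c0 pA v; rewrite -scalemxAr -scalemxAl mxE mulr_ge0. Qed.

Lemma psdmx_sum n (I : Type) (r : seq I) (P : pred I) (F : I -> 'M[C]_n) :
  (forall i, P i -> psdmx (F i)) -> psdmx (\sum_(i <- r | P i) F i).
Proof. by move=> pF; apply: big_ind => //; [exact: psdmx0|exact: psdmxD]. Qed.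

Lemma psdmx_conj m n (g : 'M[C]_(m, n)) A : psdmx A -> psdmx (g^t* *m A *m g).
Proof. by move=> pA v; move: (pA (g *m v)); rewrite adjmxM !mulmxA. Qed.

Lemma quad_delta n (A : 'M[C]_n) i j :
  (delta_mx i 0 : 'cV_n)^t* *m A *m (delta_mx j 0 : 'cV_n) = (A i j)%:M.
Proof.
rewrite -colE; apply/matrixP => a b; rewrite !ord1 trmx_delta map_delta_mx.
by rewrite -rowE !mxE eqxx mulr1n.
Qed.

Lemma psdmx_diag_ge0 n (A : 'M[C]_n) i : psdmx A -> 0 <= A i i.
Proof. by move=> /(_ (delta_mx i 0)); rewrite quad_delta mxE mulr1n. Qed.

(** By polarization, with the coefficients [1] and ['i]. *)
Lemma quad_eq0 n (A : 'M[C]_n) :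
  (forall v : 'cV_n, (v^t* *m A *m v) 0 0 = 0) -> A = 0.
Proof.
move=> A0.
have pol z i j : z * A i j + z^* * A j i = 0.
  have := A0 (delta_mx i 0 + z *: delta_mx j 0).
  rewrite adjmxD adjmxZ !(mulmxDl, mulmxDr) -!(scalemxAl, scalemxAr).
  rewrite !quad_delta.
  move: (A0 (delta_mx i 0)) (A0 (delta_mx j 0)).
  rewrite !quad_delta !mxE !eqxx !mulr1n => -> ->.
  by rewrite !mulr0 add0r addr0 addrC.
apply/matrixP => i j; rewrite mxE.
have := pol 1 i j; have := pol 'i i j; rewrite conjC1 conjCi !mul1r mulNr.
move=> /eqP; rewrite subr_eq0 => /eqP/(mulfI (neq0Ci _)) <- /eqP.
by rewrite -mulr2n mulrn_eq0 => /eqP.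
Qed.

Lemma psdmx_adj n (A : 'M[C]_n) : psdmx A -> A^t* = A.
Proof.
move=> pA; apply/eqP; rewrite -subr_eq0; apply/eqP; apply: quad_eq0 => v.
have E : v^t* *m A^t* *m v = (v^t* *m A *m v)^t*.
  by rewrite !adjmxM trmxCK mulmxA.
rewrite mulmxBr mulmxBl {}E mxE [X in _ + X]mxE adjmxE.
by apply/eqP; rewrite subr_eq0 -CrealE ger0_real.
Qed.

(** Take square roots of the eigenvalues in the spectral decomposition. *)
Lemma psdmx_gramP n (A : 'M[C]_n) :
  psdmx A -> exists T : 'M[C]_n, A = T^t* *m T.
Proof.
move=> pA.
have /orthomx_spectralP defA : A \is normalmx.
  by apply/normalmxP; rewrite psdmx_adj.
set P := spectralmx A in defA; set d := spectral_diag A in defA.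
have uP : P \is unitarymx := spectral_unitarymx A.
have defD : diag_mx d = P^t*^t* *m A *m P^t*.
  rewrite trmxCK {1}defA invmx_unitary // !mulmxA (unitarymxP uP) mul1mx.
  by rewrite -mulmxA (unitarymxP uP) mulmx1.
have d0 i : 0 <= d 0 i.
  have := psdmx_diag_ge0 i (psdmx_conj (P^t*) pA).
  by rewrite -defD !mxE eqxx mulr1n.
pose s : 'rV[C]_n := \row_i sqrtC (d 0 i).
exists (diag_mx s *m P); rewrite adjmxM mulmxA -[_ *m _ *m diag_mx s]mulmxA.
rewrite [LHS]defA invmx_unitary //; congr (_ *m _ *m _).
rewrite tr_diag_mx map_diag_mx mulmx_diag; congr diag_mx.
apply/rowP => i; rewrite !mxE /= geC0_conj ?sqrtC_ge0 //.
by rewrite -expr2 sqrtCK.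
Qed.

Lemma psdmx_ker m n (A : 'M[C]_n) (V : 'M_(n, m)) :
  psdmx A -> V^t* *m A *m V = 0 -> A *m V = 0.
Proof.
move=> /psdmx_gramP[T ->]; rewrite mulmxA -adjmxM -mulmxA => /gram_eq0 TV0.
by rewrite -mulmxA TV0 mulmx0.
Qed.

(** For [A = T^* T] this is the inequality of arithmetic and geometric means,
    applied to the products that make up the entry. *)
Lemma psdmx_entry n (A : 'M[C]_n) i j : psdmx A -> `|A i j| <= \tr A.
Proof.
move=> pA; have dle k : A k k <= \tr A.
  rewrite /mxtrace (bigD1 k) //= lerDl sumr_ge0 // => l _.
  exact: psdmx_diag_ge0.
have /psdmx_gramP[T dA] := pA.
have half : 2%:R^-1 * A i i + 2%:R^-1 * A j j <= \tr A.
  apply: (@le_trans _ _ (2%:R^-1 * \tr A + 2%:R^-1 * \tr A)).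
    by rewrite lerD // ler_wpM2l // invr_ge0 ler0n.
  by rewrite -mulrDl -[2%:R^-1]mul1r -splitr mul1r.
apply: le_trans half; rewrite dA !mxE !mulr_sumr -big_split /=.
apply: le_trans (ler_norm_sum _ _ _) _; apply: ler_sum => k _.
rewrite !adjmxE normrM norm_conjC ![_^* * _]mulrC -!normCK -mulrDr.
rewrite ler_pdivlMl ?ltr0n // -subr_ge0.
have -> : `|T k i| ^+ 2 + `|T k j| ^+ 2 - 2 * (`|T k i| * `|T k j|)
  = (`|T k i| - `|T k j|) ^+ 2 by ring.
by rewrite -realEsqr realB.
Qed.

Lemma psdmx_trace_ge0 n (A : 'M[C]_n) : psdmx A -> 0 <= \tr A.
Proof. by move=> pA; apply: sumr_ge0 => i _; apply: psdmx_diag_ge0. Qed.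

Lemma psdmx_trace_eq0 n (A : 'M[C]_n) : psdmx A -> \tr A = 0 -> A = 0.
Proof.
move=> pA trA; apply/matrixP => i j; rewrite mxE; apply/eqP.
by rewrite -normr_le0 -trA psdmx_entry.
Qed.

Lemma psdmx_tens m n (A : 'M[C]_m) (B : 'M[C]_n) :
  psdmx A -> psdmx B -> psdmx (mxtens.tensmx A B).
Proof.
move=> /psdmx_gramP[T ->] /psdmx_gramP[S ->].
by rewrite -mxtens.tensmx_mul -adjmx_tens; apply: psdmx_gram.
Qed.

Lemma mxtrace_tens m n (A : 'M[C]_m) (B : 'M[C]_n) :
  \tr (mxtens.tensmx A B) = \tr A * \tr B.
Proof.
by rewrite /mxtrace mxtens.mulr_sum; apply: eq_bigr => i _; rewrite mxE.
Qed.

(** The sum of the absolute values of the entries serves as [M], since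
    [`|v i| * `|v j|] is at most the squared norm of [v]. *)
Lemma herm_bound n (A : 'M[C]_n) : A^t* = A ->
  exists2 M, 0 <= M & psdmx (M%:M + A) /\ psdmx (M%:M - A).
Proof.
move=> hA; pose M := \sum_i \sum_j `|A i j|.
have M0 : 0 <= M by rewrite sumr_ge0 // => i _; rewrite sumr_ge0.
exists M => //.
have bnd (v : 'cV_n) : `|(v^t* *m A *m v) 0 0| <= (v^t* *m M%:M *m v) 0 0.
  rewrite mul_mx_scalar -scalemxAl [leRHS]mxE.
  have vk k : `|v k 0| ^+ 2 <= (v^t* *m v) 0 0.
    rewrite mxE (bigD1 k) //= adjmxE mulrC -normCK lerDl sumr_ge0 // => l _.
    by rewrite adjmxE mulrC mul_conjC_ge0.
  have vv i j : `|v i 0| * `|v j 0| <= (v^t* *m v) 0 0.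
    wlog le_ij : i j / `|v i 0| <= `|v j 0|.
      move=> W.
      have /orP[] := real_leVge (normr_real (v i 0)) (normr_real (v j 0)).
        exact: W.
      by rewrite mulrC; apply: W.
    by apply: le_trans (vk j); rewrite expr2 ler_wpM2r.
  rewrite -mulmxA mxE; apply: le_trans (ler_norm_sum _ _ _) _.
  rewrite mulr_suml; apply: ler_sum => i _; rewrite [(A *m v) i 0]mxE mulr_sumr.
  apply: le_trans (ler_norm_sum _ _ _) _; rewrite mulr_suml.
  apply: ler_sum => j _; rewrite adjmxE !normrM norm_conjC.
  by rewrite mulrCA ler_wpM2l.
have qreal (v : 'cV_n) : (v^t* *m A *m v) 0 0 \is Num.real.
  by rewrite CrealE -adjmxE !adjmxM trmxCK hA mulmxA.
split=> v; rewrite !(mulmxDr, mulmxDl, mulmxN, mulNmx) mxE.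
  rewrite -lerBlDr sub0r; apply: le_trans (bnd v).
  by rewrite -normrN real_ler_norm // realN.
rewrite [(- (_ : 'M__)) _ _]mxE subr_ge0; apply: le_trans (bnd v).
by rewrite real_ler_norm.
Qed.

End Adjoint.

(** * Entanglement breaking maps and their compressions *)

Section Cone.
Variables (C : numClosedFieldType) (d : nat) (S : {vspace 'M[C]_d}).
Local Notation maps n := 'Hom(subvs_of S, 'M[C]_n).

Lemma separable0 k m : separable (0 : 'M[C]_(k * m)).
Proof.
by exists 0, (fun=> 0), (fun=> 0); split; [case | rewrite big_ord0].
Qed.

Lemma separableP k m (Y : 'M[C]_(k * m)) : separable Y <->
  exists s : seq ('M[C]_k * 'M[C]_m),
    (forall p, p \in s -> psdmx p.1 /\ psdmx p.2) /\
    Y = \sum_(p <- s) mxtens.tensmx p.1 p.2.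
Proof.
split=> [[l [A [B [pAB ->]]]]|[s [ps ->]]].
  exists [seq (A i, B i) | i : 'I_l]; split; last by rewrite big_image.
  by move=> p /mapP[i _ ->]; apply: pAB.
exists (size s), (fun i => (nth (0, 0) s i).1), (fun i => (nth (0, 0) s i).2).
split=> [i|]; first by apply: ps; rewrite mem_nth.
by rewrite (big_nth (0, 0)) big_mkord.
Qed.

Lemma separableD k m (Y Z : 'M[C]_(k * m)) :
  separable Y -> separable Z -> separable (Y + Z).
Proof.
move=> /separableP[s [ps ->]] /separableP[t [pt ->]]; apply/separableP.
exists (s ++ t); rewrite big_cat; split=> // p; rewrite mem_cat.
by case/orP; [apply: ps | apply: pt].
Qed.

Lemma separableZ k m c (Y : 'M[C]_(k * m)) :
  0 <= c -> separable Y -> separable (c *: Y).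
Proof.
move=> c0 [l [A [B [pAB ->]]]].
exists l, (fun i => c *: A i), B; split=> [i|].
  by have [? ?] := pAB i; split=> //; apply: psdmxZ.
rewrite scaler_sumr; apply: eq_bigr => i _.
by apply/matrixP => a b; rewrite !mxE mulrA.
Qed.

Lemma separable_psd k m (Y : 'M[C]_(k * m)) : separable Y -> psdmx Y.
Proof.
move=> [l [A [B [pAB ->]]]]; apply: psdmx_sum => i _.
by have [? ?] := pAB i; apply: psdmx_tens.
Qed.

Lemma ampliationD k n (V : Type) (f g : V -> 'M[C]_n) (X : 'M[V]_k) :
  ampliation (fun x => f x + g x) X = ampliation f X + ampliation g X.
Proof.
rewrite /ampliation -big_split; apply: eq_bigr => i _ /=.
rewrite -big_split; apply: eq_bigr => j _ /=.
by apply/matrixP => a b; rewrite !mxE mulrDr.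
Qed.

Lemma ampliationZ k n (V : Type) c (f : V -> 'M[C]_n) (X : 'M[V]_k) :
  ampliation (fun x => c *: f x) X = c *: ampliation f X.
Proof.
rewrite /ampliation scaler_sumr; apply: eq_bigr => i _ /=.
rewrite scaler_sumr; apply: eq_bigr => j _ /=.
by apply/matrixP => a b; rewrite !mxE mulrCA.
Qed.

Lemma eq_ampliation k n (V : Type) (f g : V -> 'M[C]_n) (X : 'M[V]_k) :
  f =1 g -> ampliation f X = ampliation g X.
Proof.
by move=> fg; apply: eq_bigr => i _; apply: eq_bigr => j _; rewrite fg.
Qed.

Lemma ampliation_conj k m n (V : Type) (f : V -> 'M[C]_n) (g : 'M_(n, m))
    (X : 'M[V]_k) :
  ampliation (fun x => g^t* *m f x *m g) X =
  (mxtens.tensmx 1%:M g)^t* *m ampliation f X *m mxtens.tensmx 1%:M g.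
Proof.
rewrite /ampliation mulmx_sumr mulmx_suml; apply: eq_bigr => i _.
rewrite mulmx_sumr mulmx_suml; apply: eq_bigr => j _.
by rewrite adjmx_tens adjmx1 !mxtens.tensmx_mul mul1mx mulmx1.
Qed.

Lemma separable_conj k m n (Y : 'M[C]_(k * n)) (g : 'M_(n, m)) :
  separable Y ->
  separable ((mxtens.tensmx (1%:M : 'M_k) g)^t* *m Y *m mxtens.tensmx 1%:M g).
Proof.
move=> [l [A [B [pAB ->]]]].
exists l, A, (fun i => g^t* *m B i *m g); split=> [i|].
  by have [? ?] := pAB i; split=> //; apply: psdmx_conj.
rewrite mulmx_sumr mulmx_suml; apply: eq_bigr => i _.
by rewrite adjmx_tens adjmx1 !mxtens.tensmx_mul mul1mx mulmx1.
Qed.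

Local Notation eb := entanglement_breaking.

Lemma eb0 n : eb (0 : maps n).
Proof.
move=> k X _; rewrite (_ : ampliation _ _ = 0); first exact: separable0.
rewrite /ampliation big1 // => i _; rewrite big1 // => j _.
by rewrite lfunE /= mxtens.tensmx0.
Qed.

Lemma ebD n (Phi Psi : maps n) : eb Phi -> eb Psi -> eb (Phi + Psi).
Proof.
move=> ePhi ePsi k X pX.
rewrite (eq_ampliation _ (g := fun x => Phi x + Psi x)); last first.
  by move=> x; rewrite lfunE.
by rewrite ampliationD; apply: separableD; [apply: ePhi | apply: ePsi].
Qed.

Lemma ebZ n c (Phi : maps n) : 0 <= c -> eb Phi -> eb (c *: Phi).
Proof.
move=> c0 ePhi k X pX.
rewrite (eq_ampliation _ (g := fun x => c *: Phi x)); last first.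
  by move=> x; rewrite lfunE.
by rewrite ampliationZ; apply: separableZ => //; apply: ePhi.
Qed.

Lemma eb_sum n (I : Type) (r : seq I) (P : pred I) (F : I -> maps n) :
  (forall i, P i -> eb (F i)) -> eb (\sum_(i <- r | P i) F i).
Proof. by move=> eF; apply: big_ind => //; [exact: eb0 | exact: ebD]. Qed.

(** Since [g] may be rectangular, compressions relate the cones of entanglement
    breaking maps into matrices of different sizes. *)
Definition compress m n (g : 'M[C]_(n, m)) (Phi : maps n) : maps m :=
  (linfun (mulmxr g \o mulmx (g^t*)) \o Phi)%VF.

Lemma compressE m n (g : 'M[C]_(n, m)) (Phi : maps n) X :
  compress g Phi X = g^t* *m Phi X *m g.
Proof. by rewrite lfunE /= lfunE. Qed.

Lemma compressD m n (g : 'M[C]_(n, m)) (Phi Psi : maps n) :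
  compress g (Phi + Psi) = compress g Phi + compress g Psi.
Proof.
by apply/lfunP => X; rewrite add_lfunE !compressE add_lfunE mulmxDr mulmxDl.
Qed.

Lemma compressN m n (g : 'M[C]_(n, m)) (Phi : maps n) :
  compress g (- Phi) = - compress g Phi.
Proof.
by apply/lfunP => X; rewrite opp_lfunE !compressE opp_lfunE mulmxN mulNmx.
Qed.

Lemma compressZ m n (g : 'M[C]_(n, m)) c (Phi : maps n) :
  compress g (c *: Phi) = c *: compress g Phi.
Proof.
apply/lfunP => X; rewrite scale_lfunE !compressE scale_lfunE.
by rewrite -scalemxAr -scalemxAl.
Qed.

Lemma compress0 m n (g : 'M[C]_(n, m)) : compress g 0 = 0.
Proof. by rewrite -[X in compress g X](scale0r 0) compressZ scale0r. Qed.

Lemma compressM m n p (g : 'M[C]_(n, m)) (h : 'M_(p, n)) (Phi : maps p) :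
  compress g (compress h Phi) = compress (h *m g) Phi.
Proof. by apply/lfunP => X; rewrite !compressE adjmxM !mulmxA. Qed.

Lemma compress1 n (Phi : maps n) : compress 1%:M Phi = Phi.
Proof. by apply/lfunP => X; rewrite compressE adjmx1 mul1mx mulmx1. Qed.

Lemma compress_scalar n c (Phi : maps n) :
  compress c%:M Phi = `|c| ^+ 2 *: Phi.
Proof.
apply/lfunP => X; rewrite compressE scale_lfunE adjmx_scalar mul_scalar_mx.
by rewrite mul_mx_scalar scalerA normCK.
Qed.

Lemma compress_sqrt n c (Phi : maps n) : 0 <= c ->
  compress (sqrtC c)%:M Phi = c *: Phi.
Proof.
by move=> c0; rewrite compress_scalar ger0_norm ?sqrtC_ge0 // sqrtCK.
Qed.

Lemma eb_compress m n (g : 'M[C]_(n, m)) (Phi : maps n) :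
  eb Phi -> eb (compress g Phi).
Proof.
move=> ePhi k X pX.
rewrite (eq_ampliation _ (g := fun x => g^t* *m Phi x *m g)); last first.
  by move=> x; rewrite compressE.
by rewrite ampliation_conj; apply: separable_conj; apply: ePhi.
Qed.

Hypothesis hS : operator_system S.

Definition oneS : subvs_of S := vsproj S 1%:M.

Lemma vsval_oneS : vsval oneS = 1%:M.
Proof. by rewrite vsprojK; case: hS. Qed.

Lemma unitalE n (Phi : maps n) : unital Phi <-> Phi oneS = 1%:M.
Proof.
split=> [->//|e X X1]; first exact: vsval_oneS.
by rewrite (_ : X = oneS) //; apply: val_inj; rewrite /= X1 vsval_oneS.
Qed.

Lemma vsvalD (X Y : subvs_of S) : vsval (X + Y) = vsval X + vsval Y.
Proof. exact: linearD. Qed.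

Lemma vsvalN (X : subvs_of S) : vsval (- X) = - vsval X.
Proof. exact: linearN. Qed.

Lemma vsvalZ c (X : subvs_of S) : vsval (c *: X) = c *: vsval X.
Proof. exact: linearZ. Qed.

Definition adjS (X : subvs_of S) : subvs_of S := vsproj S ((vsval X)^t*).

Lemma vsval_adjS X : vsval (adjS X) = (vsval X)^t*.
Proof. by rewrite vsprojK //; case: hS => _; apply; apply: subvsP. Qed.

(** The case [k = 1] of the definition, as separable matrices are positive. *)
Lemma eb_psd n (Phi : maps n) X : eb Phi -> psdmx (vsval X) -> psdmx (Phi X).
Proof.
move=> ePhi pX; pose XX : 'M[subvs_of S]_1 := \matrix_(i, j) X.
have amp1 m (f : subvs_of S -> 'M[C]_m) :
    ampliation f XX = mxtens.tensmx (1%:M : 'M_1) (f X).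
  rewrite /ampliation !big_ord1 mxE; congr mxtens.tensmx.
  by apply/matrixP => i j; rewrite !ord1 !mxE !eqxx.
have /ePhi/separable_psd : psdmx (ampliation vsval XX).
  by rewrite amp1; apply: psdmx_tens => //; apply: psdmx1.
rewrite amp1 => pY v; pose w := mxtens.tensmx (1%:M : 'M[C]_1) v.
have E : w^t* *m mxtens.tensmx 1%:M (Phi X) *m w =
         mxtens.tensmx 1%:M (v^t* *m Phi X *m v).
  by rewrite /w adjmx_tens adjmx1 !mxtens.tensmx_mul !mul1mx.
have : 0 <= (w^t* *m mxtens.tensmx 1%:M (Phi X) *m w : 'M_1) 0 0 := pY w.
rewrite E mxE mxE mul1r; congr (0 <= fun_of_matrix _ _ _); exact: ord1.
Qed.

Lemma eb_one_psd n (Phi : maps n) : eb Phi -> psdmx (Phi oneS).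
Proof.
move=> e; apply: eb_psd => //; rewrite vsval_oneS.
exact: psdmx1.
Qed.

Lemma herm_decomp (X : subvs_of S) : exists (H K : subvs_of S),
  [/\ X = H + ('i : C) *: K,
      (vsval H)^t* = vsval H & (vsval K)^t* = vsval K].
Proof.
exists ((2^-1 : C) *: (X + adjS X)), ((2 * 'i : C)^-1 *: (X - adjS X)).
have two : 2^-1 + 2^-1 = 1 :> C by rewrite [RHS](splitr 1) mul1r.
have i2 : 'i * (2 * 'i)^-1 = 2^-1 :> C.
  by rewrite invfM mulrCA mulfV ?mulr1 // neq0Ci.
split.
- rewrite scalerA i2 -scalerDr addrACA subrr addr0 scalerDr -scalerDl two.
  by rewrite scale1r.
- rewrite vsvalZ vsvalD vsval_adjS adjmxZ adjmxD trmxCK addrC.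
  by rewrite conj_Creal // realV realn.
- rewrite vsvalZ vsvalD vsvalN vsval_adjS adjmxZ adjmxD adjmxN trmxCK.
  rewrite -opprB scalerN -scaleNr; congr (_ *: _).
  rewrite fmorphV rmorphM /= conjCi conj_Creal ?realn // mulrN invrN opprK.
  by [].
Qed.

(** Apply positivity to [M *: 1 + X] and [M *: 1 - X]. Through this bound the
    value at the identity controls the whole map. *)
Lemma eb_dominated X : (vsval X)^t* = vsval X ->
  exists M, forall n (Phi : maps n),
  eb Phi -> psdmx (M *: Phi oneS + Phi X) /\ psdmx (M *: Phi oneS - Phi X).
Proof.
move=> /herm_bound[M _ [p1 p2]]; exists M => n Phi ePhi.
rewrite -linearZ -linearD -linearB; split; apply: eb_psd => //.
  by rewrite linearD linearZ /= vsval_oneS scalemx1.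
by rewrite linearB linearZ /= vsval_oneS scalemx1.
Qed.

Lemma eb_adj n (Phi : maps n) X : eb Phi -> Phi (adjS X) = (Phi X)^t*.
Proof.
move=> ePhi.
have herm H : (vsval H)^t* = vsval H -> (Phi H)^t* = Phi H.
  move=> /eb_dominated[M /(_ n Phi ePhi)[/psdmx_adj p /psdmx_adj q]].
  have : (M *: Phi oneS + Phi H - (M *: Phi oneS - Phi H))^t* =
         M *: Phi oneS + Phi H - (M *: Phi oneS - Phi H).
    by rewrite adjmxD adjmxN p q.
  rewrite opprB addrC addrA subrK -mulr2n.
  rewrite -scaler_nat adjmxZ conj_Creal ?realn // => /scalerI; apply.
  by rewrite pnatr_eq0.
have [H [K [-> hH hK]]] := herm_decomp X.
have -> : adjS (H + 'i *: K) = H - 'i *: K.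
  apply: val_inj; rewrite [LHS]vsval_adjS vsvalD vsvalZ.
  rewrite [RHS]vsvalD vsvalN vsvalZ.
  by rewrite adjmxD adjmxZ hH hK conjCi scaleNr.
rewrite linearB [Phi (H + _)]linearD !linearZ /= adjmxD adjmxZ !herm //.
by rewrite conjCi scaleNr scalerN.
Qed.

(** For Hermitian [H], [Phi H] lies between multiples of [Phi 1] in the order of
    Hermitian matrices, so its quadratic form vanishes with that of [Phi 1]. *)
Lemma eb_ker m n (Phi : maps n) (V : 'M_(n, m)) : eb Phi ->
  V^t* *m Phi oneS *m V = 0 -> forall X, Phi X *m V = 0.
Proof.
move=> ePhi V0.
have PV : Phi oneS *m V = 0 by apply: psdmx_ker => //; apply: eb_one_psd.
have herm H : (vsval H)^t* = vsval H -> Phi H *m V = 0.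
  move=> /eb_dominated[M /(_ n Phi ePhi)[p q]].
  have VH : V^t* *m Phi H *m V = 0.
    have psd_anti (A : 'M[C]_m) : psdmx A -> psdmx (- A) -> A = 0.
      move=> pA pA'; apply: psdmx_trace_eq0 => //.
      apply/eqP; rewrite eq_le psdmx_trace_ge0 // andbT.
      by rewrite -oppr_ge0 -raddfN psdmx_trace_ge0.
    apply: psd_anti.
      move: (psdmx_conj V p); rewrite mulmxDr mulmxDl -scalemxAr -scalemxAl.
      by rewrite V0 scaler0 add0r.
    move: (psdmx_conj V q); rewrite mulmxBr mulmxBl -scalemxAr -scalemxAl.
    by rewrite V0 scaler0 add0r.
  have : (M *: Phi oneS + Phi H) *m V = 0.
    apply: psdmx_ker => //; rewrite mulmxDr mulmxDl -scalemxAr -scalemxAl.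
    by rewrite V0 VH scaler0 addr0.
  by rewrite mulmxDl -scalemxAl PV scaler0 add0r.
move=> X; have [H [K [-> hH hK]]] := herm_decomp X.
by rewrite linearD linearZ /= mulmxDl -scalemxAl !herm // scaler0 addr0.
Qed.

Lemma eb_kerl m n (Phi : maps n) (V : 'M_(n, m)) : eb Phi ->
  V^t* *m Phi oneS *m V = 0 -> forall X, V^t* *m Phi X = 0.
Proof.
move=> ePhi V0 X; rewrite -[Phi X]trmxCK -adjmxM -eb_adj //.
by rewrite (eb_ker ePhi V0) adjmx0.
Qed.

Lemma eb_compress_ker n (Phi : maps n) (P : 'M_n) : eb Phi ->
  (1%:M - P)^t* *m Phi oneS *m (1%:M - P) = 0 -> compress P Phi = Phi.
Proof.
move=> ePhi V0; apply/lfunP => X; rewrite compressE.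
have := eb_ker ePhi V0 X; have := eb_kerl ePhi V0 X.
rewrite adjmxD adjmxN adjmx1 mulmxBl mul1mx => /eqP.
rewrite subr_eq0 => /eqP <-.
by rewrite mulmxBr mulmx1 => /eqP; rewrite subr_eq0 => /eqP <-.
Qed.

Lemma eb_eq0 n (Phi : maps n) : eb Phi -> \tr (Phi oneS) = 0 -> Phi = 0.
Proof.
move=> ePhi /psdmx_trace_eq0-/(_ (eb_one_psd ePhi)) P0.
rewrite -(@eb_compress_ker _ Phi 0) ?P0 ?mulmx0 ?mul0mx //.
by apply/lfunP => X; rewrite compressE mulmx0 lfunE.
Qed.

Lemma eb_trace_ge0 n (Phi : maps n) : eb Phi -> 0 <= \tr (Phi oneS).
Proof. by move=> /eb_one_psd/psdmx_trace_ge0. Qed.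

Lemma eb_trace_gt0 n (Phi : maps n) : eb Phi -> Phi != 0 -> 0 < \tr (Phi oneS).
Proof.
move=> ePhi P0; rewrite lt0r eb_trace_ge0 // andbT.
by apply: contra_neq P0; apply: eb_eq0.
Qed.

Lemma eb_coef_ge0 n (Phi : maps n) c : eb Phi -> Phi != 0 -> eb (c *: Phi) ->
  0 <= c.
Proof.
move=> ePhi P0 /eb_trace_ge0; rewrite scale_lfunE mxtraceZ.
by rewrite pmulr_lge0 // eb_trace_gt0.
Qed.

(** * Pure maps and a criterion for C*-extreme points *)

(** [Phi] spans an extreme ray of the cone of entanglement breaking maps. *)
Definition pure n (Phi : maps n) := [/\ eb Phi, Phi != 0 &
  forall Theta, eb Theta -> eb (Phi - Theta) -> exists c, Theta = c *: Phi].

(** Compression by [g] turns a summand of [compress h Phi] into one of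
    [Phi], and compression by [h] turns it back. *)
Lemma pure_transfer m n (g : 'M_(m, n)) (h : 'M_(n, m)) (Phi : maps n) :
  g *m h = 1%:M -> compress g (compress h Phi) = Phi ->
  pure Phi -> pure (compress h Phi).
Proof.
move=> gh1 gh [ePhi P0 pP]; split; first exact: eb_compress.
  by apply: contra_neq P0 => h0; rewrite -gh h0 compress0.
move=> Theta eT eB.
have [||c Hc] := pP (compress g Theta); first exact: eb_compress.
  by rewrite -gh -compressN -compressD; apply: eb_compress.
by exists c; rewrite -compressZ -Hc compressM gh1 compress1.
Qed.

Lemma pure_compress n (g : 'M_n) (Phi : maps n) : g \in unitmx ->
  pure Phi -> pure (compress g Phi).
Proof.
move=> ug; apply: (@pure_transfer _ _ (invmx g)); first exact: mulVmx.
by rewrite compressM mulmxV // compress1.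
Qed.

Lemma pureZ n c (Phi : maps n) : 0 < c -> pure Phi -> pure (c *: Phi).
Proof.
move=> c0 pP; rewrite -compress_sqrt ?ltW //; apply: pure_compress => //.
rewrite unitmxE det_scalar unitfE expf_neq0 //.
by rewrite sqrtC_eq0 gt_eqF.
Qed.

Lemma pure_dim_gt0 n (Phi : maps n) : pure Phi -> (0 < n)%N.
Proof.
case: n Phi => // Phi [_ /negP[]].
by apply/eqP/lfunP => X; apply/matrixP; case.
Qed.

(** Factor [Phi 1 = g^* g] with [g] of full row rank. The map vanishes on the
    kernel of [g], so nothing is lost by compressing it with a right inverse
    [h] of [g]; the result is unital. *)
Lemma pure_normalize n (Phi : maps n) : pure Phi ->
  exists r (g : 'M_(r, n)) (phi : maps r),
    [/\ (r <= n)%N, pure phi, unital phi & Phi = compress g phi].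
Proof.
move=> pP; have [ePhi _ _] := pP.
have [T dT] := psdmx_gramP (eb_one_psd ePhi).
have [c dc] := psdmx_gramP (psdmx_gram (col_base T)).
have uc : c \in unitmx.
  rewrite -row_full_unit -cokermx_eq0; apply/eqP.
  have /row_fullP[L LB] := col_base_full T.
  rewrite -[LHS]mul1mx -LB -mulmxA [X in _ *m X]gram_eq0 ?mulmx0 //.
  rewrite adjmxM -mulmxA [(col_base T)^t* *m _]mulmxA dc.
  by rewrite -mulmxA mulmx_coker !mulmx0.
have /row_freeP[D DT] := row_base_free T.
pose g := c *m row_base T; pose h := D *m invmx c.
have gh : g *m h = 1%:M.
  by rewrite /g /h mulmxA -[c *m _ *m D]mulmxA DT mulmx1 mulmxV.
have dP : Phi oneS = g^t* *m g.
  have baseE r (A : 'M[C]_(n, r)) B (U : 'M_n) :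
      A *m B = U -> U^t* *m U = B^t* *m (A^t* *m A) *m B.
    by move=> <-; rewrite adjmxM !mulmxA.
  by rewrite /g dT (baseE _ _ _ _ (mulmx_base T)) dc adjmxM !mulmxA.
have hg : compress g (compress h Phi) = Phi.
  rewrite compressM; apply: eb_compress_ker => //.
  have g0 : g *m (1%:M - h *m g) = 0.
    by rewrite mulmxBr mulmx1 mulmxA gh mul1mx subrr.
  by rewrite dP mulmxA -mulmxA g0 mulmx0.
exists (\rank T), g, (compress h Phi); split=> //; first exact: rank_leq_row.
  exact: (pure_transfer gh).
by apply/unitalE; rewrite compressE dP mulmxA -adjmxM -mulmxA gh adjmx1 mulmx1.
Qed.

(** C*-extremality expressed in the cone: [Theta] stands for one summand
    [T_i^* Psi_i T_i] of a proper C*-convex combination equal to [Phi]. *)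
Definition cext n (Phi : maps n) := UEB S n Phi /\
  forall Theta, eb Theta -> eb (Phi - Theta) -> Theta oneS \in unitmx ->
  exists Y : 'M_n, Theta = compress Y Phi.

(** If [T_i^* Psi_i T_i = Y^* Phi Y], then [Psi_i = U^* Phi U] with
    [U = Y T_i^-1], and [U] is unitary because both maps are unital. *)
Lemma cext_extreme n (Phi : maps n) : cext Phi -> cstar_extreme S n Phi.
Proof.
move=> [uP xP]; split=> // k T Psi uPsi uT [sT defP] i.
have defPhi : Phi = \sum_i compress (T i) (Psi i).
  apply/lfunP => X; rewrite defP sum_lfunE; apply: eq_bigr => j _.
  by rewrite compressE.
have eT j : eb (compress (T j) (Psi j)).
  by apply: eb_compress; case: (uPsi j).
have u1 j : Psi j oneS = 1%:M by apply/unitalE; case: (uPsi j).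
have [|||Y HY] := xP (compress (T i) (Psi i)) => //.
- by rewrite defPhi (bigD1 i) //= addrAC subrr add0r; apply: eb_sum => j _.
- by rewrite compressE u1 mulmx1 unitmx_mul adjmx_unit uT.
have defPsi : Psi i = compress (Y *m invmx (T i)) Phi.
  by rewrite -compressM -HY compressM mulmxV // compress1.
exists (Y *m invmx (T i)) => [|X]; last by rewrite [in LHS]defPsi compressE.
rewrite -trmxC_unitary; apply/unitarymxP; rewrite trmxCK.
have := u1 i; rewrite [in LHS]defPsi compressE.
by move/unitalE: (proj1 uP) => ->; rewrite mulmx1.
Qed.

(** The summands of a pure map are its multiples, and [c *: phi] is the
    compression by [sqrt c]. *)
Lemma pure_cext n (phi : maps n) : pure phi -> unital phi -> cext phi.
Proof.
move=> [ephi phi0 pphi] uphi; split=> // Theta eT eB _.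
have [c Tc] := pphi _ eT eB; exists (sqrtC c)%:M.
rewrite compress_sqrt //; apply: (@eb_coef_ge0 _ phi) => //.
by rewrite -Tc.
Qed.

End Cone.

(** * Direct sums *)

Section Blocks.
Variables (C : numClosedFieldType) (m r : nat).

Definition inlmx : 'M[C]_(m + r, m) := col_mx 1%:M 0.
Definition inrmx : 'M[C]_(m + r, r) := col_mx 0 1%:M.

Lemma adj_inlmx : inlmx^t* = row_mx 1%:M 0.
Proof. by rewrite tr_col_mx map_row_mx trmx1 trmx0 map_mx1 map_mx0. Qed.

Lemma adj_inrmx : inrmx^t* = row_mx 0 1%:M.
Proof. by rewrite tr_col_mx map_row_mx trmx1 trmx0 map_mx1 map_mx0. Qed.

Lemma inlmxK : inlmx^t* *m inlmx = 1%:M.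
Proof. by rewrite adj_inlmx mul_row_col mulmx1 mul0mx addr0. Qed.

Lemma inrmxK : inrmx^t* *m inrmx = 1%:M.
Proof. by rewrite adj_inrmx mul_row_col mulmx1 mul0mx add0r. Qed.

Lemma inlmx_inr : inlmx^t* *m inrmx = 0.
Proof. by rewrite adj_inlmx mul_row_col mulmx0 mul0mx addr0. Qed.

Lemma inrmx_inl : inrmx^t* *m inlmx = 0.
Proof. by rewrite adj_inrmx mul_row_col mulmx0 mul0mx addr0. Qed.

Lemma row_mx_inl n (A : 'M[C]_(n, m)) (B : 'M_(n, r)) : row_mx A B *m inlmx = A.
Proof. by rewrite mul_row_col mulmx1 mulmx0 addr0. Qed.

Lemma row_mx_inr n (A : 'M[C]_(n, m)) (B : 'M_(n, r)) : row_mx A B *m inrmx = B.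
Proof. by rewrite mul_row_col mulmx1 mulmx0 add0r. Qed.

Lemma inlmx_inrD : inlmx *m inlmx^t* + inrmx *m inrmx^t* = 1%:M.
Proof.
rewrite adj_inlmx adj_inrmx /inlmx /inrmx !mul_col_row !mulmx0 !mul0mx.
by rewrite !mulmx1 add_block_mx !addr0 !add0r scalar_mx_block.
Qed.

End Blocks.
Arguments inlmx {C m r}.
Arguments inrmx {C m r}.

Section DirectSum.
Variables (C : numClosedFieldType) (d : nat) (S : {vspace 'M[C]_d}).
Local Notation maps n := 'Hom(subvs_of S, 'M[C]_n).
Local Notation eb := entanglement_breaking.
Local Notation one := (oneS S).
Hypothesis hS : operator_system S.

Definition dsum m r (phi : maps m) (psi : maps r) : maps (m + r) :=
  compress (inlmx^t*) phi + compress (inrmx^t*) psi.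

Lemma dsumE m r (phi : maps m) (psi : maps r) X : dsum phi psi X =
  inlmx *m phi X *m inlmx^t* + inrmx *m psi X *m inrmx^t*.
Proof. by rewrite add_lfunE !compressE !trmxCK. Qed.

Lemma eb_dsum m r (phi : maps m) (psi : maps r) :
  eb phi -> eb psi -> eb (dsum phi psi).
Proof. by move=> ephi epsi; apply: ebD; apply: eb_compress. Qed.

Lemma dsum_block m r (phi : maps m) (psi : maps r) X :
  dsum phi psi X = block_mx (phi X) 0 0 (psi X).
Proof.
rewrite dsumE adj_inlmx adj_inrmx /inlmx /inrmx !mul_col_mx !mul1mx !mul0mx.
by rewrite !mul_mx_row !mulmx1 !mulmx0 add_col_mx addr0 add0r block_mxEv.
Qed.

Lemma dsum_unital m r (phi : maps m) (psi : maps r) :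
  unital phi -> unital psi -> unital (dsum phi psi).
Proof.
move=> /(unitalE hS) u /(unitalE hS) v; apply/(unitalE hS).
by rewrite dsum_block u v -scalar_mx_block.
Qed.

Lemma compress_dsum_inl m r (phi : maps m) (psi : maps r) :
  compress inlmx (dsum phi psi) = phi.
Proof.
rewrite compressD !compressM inlmxK inrmx_inl compress1.
by apply/lfunP => X; rewrite add_lfunE [X in _ + X]compressE mulmx0 addr0.
Qed.

Lemma compress_dsum_inr m r (phi : maps m) (psi : maps r) :
  compress inrmx (dsum phi psi) = psi.
Proof.
rewrite compressD !compressM inrmxK inlmx_inr compress1.
by apply/lfunP => X; rewrite add_lfunE compressE mulmx0 add0r.
Qed.

Lemma compress_block_dsum m r (phi : maps m) (psi : maps r)
    (A : 'M_m) (B : 'M_r) :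
  compress (block_mx A 0 0 B) (dsum phi psi) =
  dsum (compress A phi) (compress B psi).
Proof.
apply/lfunP => X; rewrite compressE !dsum_block !compressE.
rewrite tr_block_mx map_block_mx !trmx0 !map_mx0 !mulmx_block.
by rewrite !mulmx0 !mul0mx !addr0 !add0r !mul0mx.
Qed.

Lemma adj_corner m p q (Omega : maps m) (A : 'M_(m, p)) (B : 'M_(m, q)) X :
  eb Omega -> (A^t* *m Omega X *m B)^t* = B^t* *m Omega (adjS X) *m A.
Proof. by move=> eO; rewrite adjmx_quad eb_adj. Qed.

Lemma block_diagE m r (Omega : maps (m + r)) : eb Omega ->
  (forall X, inlmx^t* *m Omega X *m inrmx = 0) ->
  Omega = dsum (compress inlmx Omega) (compress inrmx Omega).
Proof.
move=> eO O0; apply/lfunP => X; rewrite dsumE !compressE.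
have O0' : inrmx^t* *m Omega X *m inlmx = 0.
  by rewrite -[LHS]trmxCK adj_corner // O0 adjmx0.
rewrite -[Omega X in LHS]mulmx1 -[Omega X in LHS]mul1mx -(inlmx_inrD C m r).
rewrite !(mulmxDl, mulmxDr) !mulmxA.
have -> : inlmx *m inlmx^t* *m Omega X *m inrmx *m inrmx^t* = 0 :> 'M_(m + r).
  rewrite -!mulmxA (mulmxA (Omega X)) !(mulmxA (inlmx^t*)).
  by rewrite O0 mul0mx mulmx0.
have -> : inrmx *m inrmx^t* *m Omega X *m inlmx *m inlmx^t* = 0 :> 'M_(m + r).
  rewrite -!mulmxA (mulmxA (Omega X)) !(mulmxA (inrmx^t*)).
  by rewrite O0' mul0mx mulmx0.
by rewrite addr0 add0r.
Qed.

(** For unital [phi] this says that each unital dilation of [phi] is a direct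
    sum. The condition at the identity takes the place of unitality of [Omega];
    elimination achieves it (see [clear_corner]). *)
Definition maximal m (phi : maps m) := forall r (Omega : maps (m + r)),
  eb Omega -> compress inlmx Omega = phi ->
  inlmx^t* *m Omega one *m inrmx = 0 ->
  forall X, inlmx^t* *m Omega X *m inrmx = 0.

(** Gaussian elimination in the positive matrix [Theta 1], whose upper left
    corner is the scalar [c]: replacing the second block of coordinates by [w]
    clears the off-diagonal corner. *)
Lemma clear_corner m r (phi : maps m) (Theta : maps (m + r)) c :
  unital phi -> 0 < c -> compress inlmx Theta = c *: phi ->
  let g := c^-1 *: (inlmx^t* *m Theta one *m inrmx) in
  let w : 'M_(m + r, r) := inrmx - inlmx *m g in
  inlmx^t* *m Theta one *m w = 0 /\
  compress ((sqrtC c)^-1 *: inlmx) Theta = phi.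
Proof.
move=> /(unitalE hS) u1 c0 Tc; split.
  have := congr1 (fun f : maps m => f one) Tc.
  rewrite /= compressE scale_lfunE u1 => E.
  rewrite mulmxBr mulmxA E scalemx1 mul_scalar_mx scalerA mulfV ?gt_eqF //.
  by rewrite scale1r subrr.
rewrite -mul_mx_scalar -compressM Tc compressZ compress_scalar.
rewrite scalerA normrV ?unitfE ?sqrtC_eq0 ?gt_eqF //.
by rewrite ger0_norm ?sqrtC_ge0 ?ltW // exprVn sqrtCK mulfV ?gt_eqF // scale1r.
Qed.

(** Let [Theta] be a summand of [phi (+) psi] with invertible value at the
    identity. Purity makes its first corner a multiple of [phi], maximality
    turns it, after elimination, into a direct sum, and the second corner of
    this sum is a summand of [psi], to which the hypothesis on [psi] applies. *)
Lemma cext_dsum m r (phi : maps m) (psi : maps r) :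
  pure phi -> unital phi -> maximal phi -> cext psi -> cext (dsum phi psi).
Proof.
move=> pphi uphi mphi [[upsi epsi] xpsi].
have [ephi phi0 rphi] := pphi; have m_gt0 := pure_dim_gt0 pphi.
have eps : eb (dsum phi psi) by apply: eb_dsum.
split; first by split=> //; apply: dsum_unital.
move=> Theta eT eB uT.
have [||c Tc] := rphi (compress inlmx Theta); first exact: eb_compress.
  rewrite -(compress_dsum_inl phi psi) -compressN -compressD.
  exact: eb_compress.
have c_ge0 : 0 <= c.
  by apply: (eb_coef_ge0 hS ephi phi0); rewrite -Tc; apply: eb_compress.
have c0 : 0 < c.
  rewrite lt0r c_ge0 andbT; apply/eqP => c0; move: Tc; rewrite c0 scale0r => Tc.
  have := congr1 (fun f : maps m => f one) Tc; rewrite compressE lfunE /= => T0.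
  have := eb_ker hS eT T0 one => /(congr1 (mulmx (invmx (Theta one)))).
  rewrite mulKmx // mulmx0 => /(congr1 (mulmx ((@inlmx C m r)^t*))).
  rewrite inlmxK mulmx0 => /matrixP/(_ (Ordinal m_gt0) (Ordinal m_gt0)).
  by rewrite !mxE eqxx => /eqP; rewrite oner_eq0.
have /= := clear_corner uphi c0 Tc.
set g := _ *: (_ *m _); set w := _ - _ => -[w0 wphi].
have Tw X : inlmx^t* *m Theta X *m w = 0.
  pose V := row_mx ((sqrtC c)^-1 *: inlmx) w.
  have := mphi _ (compress V Theta).
  rewrite compressM row_mx_inl wphi => /(_ (eb_compress _ eT) erefl).
  have E Y : inlmx^t* *m compress V Theta Y *m inrmx =
      (sqrtC c)^-1^* *: (inlmx^t* *m Theta Y *m w).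
    rewrite compressE !mulmxA -adjmxM row_mx_inl -[_ *m _ *m inrmx]mulmxA.
    by rewrite row_mx_inr adjmxZ -!scalemxAl.
  rewrite E w0 scaler0 => /(_ erefl X); rewrite E => /eqP; rewrite scaler_eq0.
  by rewrite conjC_eq0 invr_eq0 sqrtC_eq0 gt_eqF //= => /eqP.
(* [Q] performs the elimination and [Q'] undoes it. *)
pose Q := row_mx inlmx w; pose Q' := row_mx inlmx (inrmx + inlmx *m g).
have Ql : Q *m inlmx = inlmx by rewrite row_mx_inl.
have Qr : Q *m inrmx = w by rewrite row_mx_inr.
have QK : Q *m Q' = 1%:M.
  rewrite mul_mx_row Ql mulmxDr mulmxA Ql Qr subrK.
  by rewrite /inlmx /inrmx -block_mxEh -scalar_mx_block.
have [uQ _] := mulmx1_unit QK.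
pose Theta2 := compress w Theta.
have eT2 : eb Theta2 by apply: eb_compress.
have split_Theta : compress Q Theta = dsum (c *: phi) Theta2.
  rewrite (block_diagE (eb_compress Q eT)) ?compressM ?Ql ?Qr ?Tc // => X.
  by rewrite compressE !mulmxA -adjmxM Ql -mulmxA Qr Tw.
have uT2 : Theta2 one \in unitmx.
  have : compress Q Theta one \in unitmx.
    by rewrite compressE !unitmx_mul adjmx_unit uQ uT.
  by rewrite split_Theta dsum_block unitmxE det_ublock unitrM => /andP[].
(* [psi - Theta2] is a corner of the complement of [Theta] plus the Schur
   correction, a compression of [Theta]. *)
have eB2 : eb (psi - Theta2).
  have -> : psi - Theta2 =
      compress inrmx (dsum phi psi - Theta) + compress (inlmx *m g) Theta.
    rewrite compressD compressN compress_dsum_inr -addrA; congr (_ + _).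
    apply/lfunP => X; rewrite add_lfunE !opp_lfunE !compressE.
    have Tw' : w^t* *m Theta X *m inlmx = 0.
      by rewrite -[LHS]trmxCK adj_corner // Tw adjmx0.
    pose u : 'M_(m + r, r) := inlmx *m g.
    have Tu : w^t* *m Theta X *m u = 0 by rewrite /u mulmxA Tw' mul0mx.
    have Tu' : u^t* *m Theta X *m w = 0.
      by rewrite /u adjmxM -mulmxA -mulmxA [inlmx^t* *m _]mulmxA Tw mulmx0.
    have -> : inrmx = w + u by rewrite subrK.
    by rewrite (quadD Tu Tu') opprD subrK.
  by apply: ebD; apply: eb_compress.
have [y Ty] := xpsi _ eT2 eB2 uT2.
exists (block_mx (sqrtC c)%:M 0 0 y *m Q').
rewrite -compressM compress_block_dsum compress_sqrt // -Ty -split_Theta.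
by rewrite compressM QK compress1.
Qed.

End DirectSum.

(** * Limits along an ultrafilter *)

Section UltraLimit.
Variables (R : realType) (U : set_system nat).
Hypothesis ultraU : UltraFilter U.
Local Notation C := R[i].

(** Convergence along an ultrafilter is compatible with the algebraic operations
    in the usual way, and every bounded sequence converges; there are no
    subsequences to keep track of. *)
Definition tends (z : nat -> C) (l : C) :=
  forall e, 0 < e -> U [set j | `|z j - l| < e]%classic.

Lemma ultraI A B : U A -> U B -> U (A `&` B)%classic.
Proof. exact: filterI. Qed.

Lemma ultra_ex A : U A -> exists j, A j.
Proof. exact: filter_ex. Qed.

Lemma tends_dominated z w l l' k : 0 < k ->
  (forall j, `|w j - l'| <= k * `|z j - l|) -> tends z l -> tends w l'.
Proof.
move=> k0 H zl e e0; have := zl (e / k) (divr_gt0 e0 k0).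
apply: filterS => j /=; rewrite ltr_pdivlMr // mulrC => lt.
exact: le_lt_trans (H j) lt.
Qed.

Lemma tends_eq z l : (forall j, z j = l) -> tends z l.
Proof.
by move=> zl e e0; apply: filterS filterT => j _ /=; rewrite zl subrr normr0.
Qed.

Lemma tendsD z w a b : tends z a -> tends w b ->
  tends (fun j => z j + w j) (a + b).
Proof.
move=> za wb e e0; have e2 : 0 < e / 2 by rewrite divr_gt0 ?ltr0n.
apply: filterS (ultraI (za _ e2) (wb _ e2)) => j [] /= lt1 lt2.
rewrite opprD addrACA [e]splitr; apply: le_lt_trans (ler_normD _ _) _.
exact: ltrD.
Qed.

Lemma tendsM z w a b : tends z a -> tends w b ->
  tends (fun j => z j * w j) (a * b).
Proof.
move=> za wb e e0.
pose K := `|a| + `|b| + 1.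
have K0 : 0 < K by rewrite ltr_wpDl ?addr_ge0 ?ltr01.
have d0 : 0 < e / (2 * K) by rewrite divr_gt0 // mulr_gt0 ?ltr0n.
apply: filterS (ultraI (za _ d0) (ultraI (wb _ d0) (wb _ ltr01))).
move=> j [] /= lt1 [] lt2 lt3.
have -> : z j * w j - a * b = (z j - a) * w j + a * (w j - b) by ring.
apply: le_lt_trans (ler_normD _ _) _; rewrite !normrM.
have wK : `|w j| <= K.
  rewrite -[w j](subrK b); apply: le_trans (ler_normD _ _) _.
  rewrite /K [_ + 1]addrC; apply: lerD; first exact: ltW.
  by rewrite lerDr.
have aK : `|a| <= K by rewrite /K -addrA lerDl addr_ge0 ?ler01.
have -> : e = e / (2 * K) * K + K * (e / (2 * K)).
  by field; rewrite gt_eqF.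
apply: ltr_leD.
  apply: (@le_lt_trans _ _ (`|z j - a| * K)); first by rewrite ler_wpM2l.
  by rewrite ltr_pM2r.
apply: (@le_trans _ _ (K * `|w j - b|)); first by rewrite ler_wpM2r.
by rewrite ler_wpM2l // ltW.
Qed.

Lemma tends_conj z a : tends z a -> tends (fun j => (z j)^*%R) (a^*%R).
Proof.
apply: (tends_dominated ltr01) => j; rewrite mul1r -rmorphB /=.
by rewrite norm_conjC.
Qed.

Lemma tends_sum (I : finType) (z : nat -> I -> C) a :
  (forall i, tends (fun j => z j i) (a i)) ->
  tends (fun j => \sum_i z j i) (\sum_i a i).
Proof.
move=> za; elim: (index_enum I) => [|i r IH].
  by apply: tends_eq => j; rewrite !big_nil.
have := tendsD (za i) IH; apply: (tends_dominated ltr01) => j.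
by rewrite !big_cons mul1r.
Qed.

Lemma tends_uniq z a b : tends z a -> tends z b -> a = b.
Proof.
move=> za zb; apply/eqP; rewrite -subr_eq0 -normr_eq0; apply/eqP.
apply/eqP; apply: contraT => ne0.
have e0 : 0 < `|a - b| / 2 by rewrite divr_gt0 ?ltr0n // lt0r ne0 normr_ge0.
have /ultra_ex[j [] /= lt1 lt2] := ultraI (za _ e0) (zb _ e0).
have := ltrD lt1 lt2; rewrite -splitr => /(le_lt_trans _) H.
have := H `|a - b|; rewrite ltxx => -> //.
rewrite distrC [X in _ <= X + _]distrC.
have -> : b - a = (z j - a) - (z j - b) by ring.
by apply: le_trans (ler_normB _ _) _; rewrite [`|a - z j|]distrC.
Qed.

Lemma tends_ge0 z a : (forall j, 0 <= z j) -> tends z a -> 0 <= a.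
Proof.
move=> z0 za.
have ra : a \is Num.real.
  rewrite CrealE; apply/eqP; apply: (tends_uniq _ za).
  apply: (tends_dominated ltr01 _ (tends_conj za)) => j.
  by rewrite mul1r [(z j)^*%R]geC0_conj.
rewrite real_leNgt ?real0 //; apply/negP => a0.
have na : 0 < - a by rewrite oppr_gt0.
have /ultra_ex[j /= lt] := za _ na.
have rz : z j - a \is Num.real by rewrite realB // ger0_real.
have le : - a <= z j - a by rewrite lerDr.
by have := le_lt_trans le (real_ltr_normlW rz lt); rewrite ltxx.
Qed.

(** The limit is the supremum of the [r] such that [r <= x j] for almost all
    [j]. *)
Lemma ultra_real_bounded (x : nat -> R) M :
  (forall j, - M <= x j <= M) ->
  exists l, forall e, 0 < e -> U [set j | `|x j - l| < e]%classic.
Proof.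
move=> bx; pose E : set R := [set r | U [set j | r <= x j]]%classic.
have EM : E (- M).
  by apply: filterS filterT => j _ /=; have /andP[] := bx j.
have ubE : ubound E M.
  move=> r /ultra_ex[j /= rx]; apply: le_trans rx _.
  by have /andP[] := bx j.
have sE : has_sup E by split; [exists (- M) | exists M].
exists (sup E) => e e0.
have [r Er lr] := sup_adherent e0 sE.
have [Uc|Uc] := in_ultra_setVsetC [set j | sup E + e / 2 <= x j]%classic ultraU.
  have := ub_le_sup (ex_intro _ M ubE) Uc.
  by rewrite gerDl leNgt divr_gt0 ?ltr0n.
apply: filterS (ultraI Er Uc) => j [] /= rx /negP; rewrite -ltNge => xs.
rewrite ltr_norml; apply/andP; split.
  by rewrite ltrBrDr addrC; apply: lt_le_trans lr rx.
rewrite ltrBlDr addrC; apply: lt_trans xs _.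
by rewrite ltrD2l ltr_pdivrMr ?ltr0n // ltr_pMr // ltr1n.
Qed.

Lemma tends_bounded z M : (forall j, `|z j| <= M) -> exists l, tends z l.
Proof.
move=> zM.
have M0 : 0 <= M by apply: le_trans (zM 0%N).
have MR : M = (complex.Re M)%:C%C by rewrite RRe_real // ger0_real.
have bnd (f : C -> R) : (forall c : C, `|f c|%:C%C <= `|c|) ->
    exists l, tends (fun j => (f (z j))%:C%C) l.
  move=> fc.
  have [|l Hl] := @ultra_real_bounded (f \o z) (complex.Re M).
    move=> j /=; rewrite -ler_norml -lecR -MR.
    exact: le_trans (fc _) (zM j).
  exists (l%:C%C) => e e0.
  have eR : e = (complex.Re e)%:C%C by rewrite RRe_real // gtr0_real.
  have e0' : 0 < complex.Re e by rewrite -ltcR -eR.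
  apply: filterS (Hl _ e0') => j /=; rewrite -ltcR -eR.
  suff -> : `|f (z j) - l|%:C%C = `|(f (z j))%:C%C - l%:C%C| by [].
  rewrite -rmorphB normc_def /= expr0n addr0 sqrtr_sqr //.
have [a Ha] := bnd (@complex.Re R) (@normc_ge_Re R).
have [|b Hb] := bnd (@complex.Im R).
  move=> c; have := normc_ge_Re (c * 'i%C); rewrite ReiNIm normrN normrM.
  rewrite (_ : `|'i%C| = 1) ?mulr1 //.
  by rewrite normc_def /= expr0n expr1n add0r sqrtr1.
exists (a + 'i%C * b).
have := tendsD Ha (tendsM (tends_eq (fun=> erefl 'i%C)) Hb).
by apply: (tends_dominated ltr01) => j; rewrite mul1r -complexE.
Qed.

Definition mtends m n (Z : nat -> 'M[C]_(m, n)) (L : 'M[C]_(m, n)) :=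
  forall i j, tends (fun k => Z k i j) (L i j).

Lemma mtends_bounded m n (Z : nat -> 'M[C]_(m, n)) M :
  (forall k i j, `|Z k i j| <= M) -> exists L, mtends Z L.
Proof.
move=> ZM.
have /choice[L HL] : forall p : 'I_m * 'I_n, exists l,
    tends (fun k => Z k p.1 p.2) l.
  by move=> p; apply: (@tends_bounded _ M).
exists (\matrix_(i, j) L (i, j)) => i j; rewrite mxE.
exact: (HL (i, j)).
Qed.

Lemma mtends_psd n (Z : nat -> 'M[C]_n) L :
  (forall k, psdmx (Z k)) -> mtends Z L -> psdmx L.
Proof.
move=> pZ ZL v; apply: (@tends_ge0 (fun k => (v^t* *m Z k *m v) 0 0)).
  by move=> k; apply: pZ.
rewrite mxE.
apply: (@tends_dominated (fun k => \sum_j (v^t* *m Z k) 0 j * v j 0)).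
- exact: ltr01.
- by move=> k; rewrite mul1r mxE.
apply: tends_sum => j; apply: tendsM; last exact: tends_eq.
rewrite mxE; apply: (@tends_dominated (fun k => \sum_i v^t* 0 i * Z k i j)).
- exact: ltr01.
- by move=> k; rewrite mul1r mxE.
by apply: tends_sum => i; apply: tendsM => //; apply: tends_eq.
Qed.

End UltraLimit.

(** * The cone of separable matrices is closed *)

Section PsdPair.
Variable C : numClosedFieldType.

Definition psdpair k m (p : 'M[C]_k * 'M[C]_m) := psdmx p.1 /\ psdmx p.2.

(** Move the scalar [\tr A] from the first factor to the second; then both
    factors are bounded in terms of the product. *)
Lemma psdpair_normalize k m (p : 'M[C]_k * 'M[C]_m) : psdpair p ->
  exists q : 'M[C]_k * 'M[C]_m, [/\ psdpair q,
    mxtens.tensmx q.1 q.2 = mxtens.tensmx p.1 p.2, \tr q.1 <= 1 &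
    \tr q.2 <= \tr (mxtens.tensmx p.1 p.2)].
Proof.
case: p => A B [/= pA pB]; rewrite mxtrace_tens.
have [A0|A0] := eqVneq (\tr A) 0.
  exists (0, 0); rewrite /= A0 mul0r !mxtrace0 ler01 (psdmx_trace_eq0 pA A0).
  by split=> //; [split; apply: psdmx0 | rewrite !mxtens.tens0mx].
exists ((\tr A)^-1 *: A, \tr A *: B); rewrite /= !mxtraceZ mulVf //; split=> //.
  by split; apply: psdmxZ; rewrite // ?invr_ge0 psdmx_trace_ge0.
by apply/matrixP => a b; rewrite !mxE mulrACA mulVf // mul1r.
Qed.

End PsdPair.

Section Caratheodory.
Variable R : realType.
Local Notation C := R[i].

(** Complex linear dependence of Hermitian matrices is real linear dependence:
    apply the adjoint to a complex relation and take real or imaginary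
    parts. *)
Lemma hermitian_dependency q l (y : 'I_l -> 'M[C]_q) :
  (q * q < l)%N -> (forall i, (y i)^t* = y i) ->
  exists2 r : 'I_l -> R, (exists i, 0 < r i) & \sum_i (r i)%:C%C *: y i = 0.
Proof.
move=> ql hy; pose M := \matrix_i mxvec (y i).
have kM : kermx M != 0.
  rewrite kermx_eq0 -row_leq_rank -ltnNge.
  exact: leq_ltn_trans (rank_leq_col M) ql.
have [i0 wi0] : exists i, row i (kermx M) != 0.
  apply/existsP; apply: contraR kM; rewrite negb_exists => /forallP H.
  apply/eqP/row_matrixP => i; rewrite row0; apply/eqP.
  by have := H i; rewrite negbK.
set w := row i0 _ in wi0.
have wy : \sum_i w 0 i *: y i = 0.
  apply: (can_inj mxvecK); rewrite linear_sum linear0 /=.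
  transitivity (w *m M); last by rewrite -row_mul mulmx_ker row0.
  rewrite mulmx_sum_row; apply: eq_bigr => i _.
  by rewrite linearZ /= rowK.
have wy' : \sum_i (w 0 i)^* *: y i = 0.
  rewrite -[RHS](adjmx0 _ q q) -[in RHS]wy adjmx_sum; apply: eq_bigr => i _.
  by rewrite adjmxZ hy.
suff [r [i ri] Hr] : exists2 r : 'I_l -> R, (exists i, r i != 0) &
    \sum_i (r i)%:C%C *: y i = 0.
  have [r0|r0] := ltP 0 (r i); first by exists r => //; exists i.
  exists (fun i => - r i); first by exists i; rewrite oppr_gt0 lt_neqAle ri.
  have H : - (\sum_i (r i)%:C%C *: y i) = 0 by rewrite Hr oppr0.
  rewrite -[RHS]H -sumrN; apply: eq_bigr => j _.
  by rewrite rmorphN scaleNr.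
have /rV0Pn[i wi] := wi0.
have ReP : \sum_i (complex.Re (w 0 i))%:C%C *: y i = 0.
  have H : 2^-1 *: (\sum_i w 0 i *: y i + \sum_i (w 0 i)^* *: y i) = 0.
    by rewrite wy wy' addr0 scaler0.
  rewrite -[RHS]H -big_split scaler_sumr.
  apply: eq_bigr => j _ /=; rewrite -scalerDl scalerA.
  by rewrite ReJ_add mulrC.
have ImP : \sum_i (complex.Im (w 0 i))%:C%C *: y i = 0.
  have H : ('i%C / 2) *: (\sum_i (w 0 i)^* *: y i - \sum_i w 0 i *: y i) = 0.
    by rewrite wy wy' subrr scaler0.
  rewrite -[RHS]H -sumrB scaler_sumr.
  apply: eq_bigr => j _ /=; rewrite -scalerBl scalerA.
  by rewrite ImJ_sub mulrC mulrAC mulrA.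
have [Re0|] := eqVneq (complex.Re (w 0 i)) 0; last first.
  by move=> ?; exists (fun i => complex.Re (w 0 i)) => //; exists i.
exists (fun i => complex.Im (w 0 i)) => //; exists i.
by apply: contra wi => /eqP Im0; rewrite [w 0 i]complexE Re0 Im0 mulr0 addr0.
Qed.

(** Caratheodory: given too many summands, move along a real relation between
    them until the first coefficient vanishes. *)
Lemma caratheodory k m (s : seq ('M[C]_k * 'M[C]_m)) :
  (forall p, p \in s -> psdpair p) -> exists t : seq ('M[C]_k * 'M[C]_m),
  [/\ forall p, p \in t -> psdpair p, (size t <= (k * m) * (k * m))%N &
      \sum_(p <- t) mxtens.tensmx p.1 p.2 =
      \sum_(p <- s) mxtens.tensmx p.1 p.2].
Proof.
have [l] := ubnP (size s); elim: l s => // l IH s lel ps.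
have [sN|Ns] := leqP (size s) ((k * m) * (k * m)); first by exists s.
pose y (i : 'I_(size s)) := mxtens.tensmx (nth (0, 0) s i).1 (nth (0, 0) s i).2.
have psi (i : 'I_(size s)) : psdpair (nth (0, 0) s i).
  by apply: ps; rewrite mem_nth.
have hy i : (y i)^t* = y i.
  by apply: psdmx_adj; have [? ?] := psi i; apply: psdmx_tens.
have [r [j rj] Hr] := hermitian_dependency Ns hy.
pose i0 := [arg max_(i > j) r i]%O.
have rmax i : r i <= r i0.
  by rewrite /i0; case: arg_maxP => // i1 _; apply.
have r0 : 0 < r i0 by apply: lt_le_trans rj (rmax j).
pose c i := 1 - r i / r i0.
have c0 i : 0 <= c i by rewrite subr_ge0 ler_pdivrMr // mul1r.
have ci0 : c i0 = 0 by rewrite /c divff ?subrr // gt_eqF.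
pose t := [seq ((c i)%:C%C *: (nth (0, 0) s i).1, (nth (0, 0) s i).2)
            | i <- enum 'I_(size s) & i != i0].
have pt p : p \in t -> psdpair p.
  move=> /mapP[i _ ->]; have [p1 p2] := psi i; split=> //=.
  by apply: psdmxZ => //; rewrite ler0c.
have st : (size t < l)%N.
  rewrite size_map size_filter.
  move: lel; rewrite ltnS => /(leq_trans _); apply.
  rewrite -[X in (_ < X)%N]size_enum_ord -(count_predC (pred1 i0)).
  rewrite -[X in (X < _)%N]add0n ltn_add2r -has_count; apply/hasP.
  by exists i0; rewrite ?mem_enum //=.
have [u [pu su eu]] := IH t st pt; exists u; split=> //; rewrite eu.
rewrite big_map big_filter big_enum_cond /=.
transitivity (\sum_i (c i)%:C%C *: y i).
  rewrite [RHS](bigD1 i0) //= ci0 scale0r add0r; apply: eq_bigr => i _.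
  by apply/matrixP => a b; rewrite !mxE mulrA.
transitivity (\sum_i y i - (r i0)^-1%:C%C *: \sum_i (r i)%:C%C *: y i);
  last first.
  by rewrite Hr scaler0 subr0 [RHS](big_nth (0, 0)) big_mkord.
rewrite scaler_sumr -sumrB; apply: eq_bigr => i _.
have -> : (c i)%:C%C = 1 - (r i0)^-1%:C%C * (r i)%:C%C.
  by rewrite /c rmorphB rmorph1 rmorphM /= mulrC.
by rewrite scalerBl scale1r scalerA.
Qed.

Lemma separable_bounded k m (Y : 'M[C]_(k * m)) : separable Y ->
  exists p : 'I_((k * m) * (k * m)) -> 'M[C]_k * 'M[C]_m,
    (forall i, [/\ psdpair (p i), \tr (p i).1 <= 1 & \tr (p i).2 <= \tr Y]) /\
    Y = \sum_i mxtens.tensmx (p i).1 (p i).2.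
Proof.
move=> /separableP[s [ps ->]]; have [t [pt st <-]] := caratheodory ps.
pose f i := nth (0, 0) t i.
have pf i : psdpair (f i).
  have [it|it] := ltnP i (size t); first by apply: pt; rewrite mem_nth.
  by rewrite /f nth_default //; split; apply: psdmx0.
have sumE : \sum_(p <- t) mxtens.tensmx p.1 p.2 =
    \sum_(i < (k * m) * (k * m)) mxtens.tensmx (f i).1 (f i).2.
  rewrite (big_nth (0, 0)).
  rewrite -(big_mkord xpredT (fun i => mxtens.tensmx (f i).1 (f i).2)).
  rewrite [RHS](big_cat_nat (n := size t)) //= [X in _ = _ + X]big_nat_cond.
  rewrite [X in _ = _ + X]big1 ?addr0 // => i /andP[/andP[it _] _].
  by rewrite /f nth_default // mxtens.tens0mx.
have /choice[q Hq] : forall i : 'I_((k * m) * (k * m)), exists q, [/\ psdpair q,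
    mxtens.tensmx q.1 q.2 = mxtens.tensmx (f i).1 (f i).2, \tr q.1 <= 1 &
    \tr q.2 <= \tr (mxtens.tensmx (f i).1 (f i).2)].
  by move=> i; apply: psdpair_normalize.
exists q; rewrite sumE; split=> [i|]; last first.
  by apply: eq_bigr => i _; case: (Hq i).
have [? _ ? trq] := Hq i; split=> //; apply: le_trans trq _.
rewrite raddf_sum (bigD1 i) //= lerDl sumr_ge0 // => j _.
by apply: psdmx_trace_ge0; have [? ?] := pf j; apply: psdmx_tens.
Qed.

(** With a fixed number of summands and bounded factors, the limit can be taken
    factor by factor. *)
Lemma separable_closed U k m (Z : nat -> 'M[C]_(k * m)) Y c : UltraFilter U ->
  (forall j, separable (Z j)) -> (forall j, \tr (Z j) <= c) ->
  mtends U Z Y -> separable Y.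
Proof.
move=> ultraU sZ trZ ZY.
have /choice[p Hp] := fun j => separable_bounded (sZ j).
have /choice[A HA] : forall i, exists A, mtends U (fun j => (p j i).1) A.
  move=> i; apply: (@mtends_bounded _ _ ultraU _ _ _ 1) => j a b.
  have [H _] := Hp j; have [[pA _] trA _] := H i.
  exact: le_trans (psdmx_entry _ _ pA) trA.
have /choice[B HB] : forall i, exists B, mtends U (fun j => (p j i).2) B.
  move=> i; apply: (@mtends_bounded _ _ ultraU _ _ _ c) => j a b.
  have [H _] := Hp j; have [[_ pB] _ trB] := H i.
  exact: le_trans (psdmx_entry _ _ pB) (le_trans trB (trZ j)).
exists ((k * m) * (k * m))%N, A, B; split=> [i|].
  split; [apply: (mtends_psd ultraU _ (HA i)) |
          apply: (mtends_psd ultraU _ (HB i))];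
    by move=> j; have [H _] := Hp j; have [[]] := H i.
apply/matrixP => a b; apply: (tends_uniq ultraU (ZY a b)).
rewrite summxE.
apply: (@tends_dominated _ _ ultraU
  (fun j => \sum_i mxtens.tensmx (p j i).1 (p j i).2 a b) _ _ _ 1).
- exact: ltr01.
- by move=> j; rewrite mul1r [in leLHS](proj2 (Hp j)) summxE.
apply: tends_sum => // i; rewrite mxE.
apply: (@tends_dominated _ _ ultraU (fun j =>
  (p j i).1 (mxtens.mxtens_unindex a).1
  (mxtens.mxtens_unindex b).1 * (p j i).2 (mxtens.mxtens_unindex a).2
  (mxtens.mxtens_unindex b).2) _ _ _ 1).
- exact: ltr01.
- by move=> j; rewrite mul1r mxE.
by apply: tendsM => //; [apply: HA | apply: HB].
Qed.

End Caratheodory.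

(** * Sums of pure maps *)

(** Closedness of the cone along rays, in the form in which the convexity
    argument uses it. Beyond this property nothing depends on the completeness
    of the real numbers, so what follows from it holds over any [C]. *)
Definition max_multiple (C : numClosedFieldType) d (S : {vspace 'M[C]_d}) :=
  forall n (Phi Theta : 'Hom(subvs_of S, 'M[C]_n)),
  entanglement_breaking Phi -> Phi != 0 -> entanglement_breaking Theta ->
  exists u : C, [/\ 0 <= u, entanglement_breaking (Theta - u *: Phi) &
    forall e, 0 < e -> ~ entanglement_breaking (Theta - (u + e) *: Phi)].

Section MaxMultiple.
Variables (R : realType) (d : nat) (S : {vspace 'M[R[i]]_d}).
Hypothesis hS : operator_system S.
Local Notation C := R[i].
Local Notation maps n := 'Hom(subvs_of S, 'M[C]_n).
Local Notation eb := entanglement_breaking.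
Local Notation one := (oneS S).

(** Along an ultrafilter finer than the filter of cofinite sets, ordinary limits
    are limits; only one rate of convergence occurs below. *)
Lemma ultrafilter_nat : exists U : set_system nat, UltraFilter U /\
  forall (u : nat -> R) l, (forall j, l - j.+1%:R^-1 < u j <= l) ->
  tends U (fun j => (u j)%:C%C) l%:C%C.
Proof.
have [U [ultraU oU]] := ultraFilterLemma eventually_filter.
exists U; split=> // u l ul e e0.
have eR : e = (complex.Re e)%:C%C by rewrite RRe_real // gtr0_real.
have e0' : 0 < complex.Re e by rewrite -ltcR -eR.
apply: oU; exists (Num.bound (complex.Re e)^-1) => // j /= Nj.
have /andP[lu ul'] := ul j.
rewrite -rmorphB normc_def /= expr0n addr0 sqrtr_sqr eR ltcR.
rewrite distrC ger0_norm ?subr_ge0 //.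
apply: (@lt_trans _ _ j.+1%:R^-1); first by rewrite ltrBlDr -ltrBlDl.
rewrite invf_plt ?posrE ?ltr0n //.
apply: lt_le_trans (archi_boundP _) _; first by rewrite invr_ge0 ltW.
by rewrite ler_nat; apply: leq_trans Nj _.
Qed.

Lemma ampliationB k n (Phi Theta : maps n) u (X : 'M[subvs_of S]_k) :
  ampliation (Theta - u *: Phi) X = ampliation Theta X - u *: ampliation Phi X.
Proof.
rewrite (eq_ampliation _ (g := fun x => Theta x + - u *: Phi x)); last first.
  by move=> x; rewrite add_lfunE opp_lfunE scale_lfunE scaleNr.
by rewrite ampliationD ampliationZ scaleNr.
Qed.

Lemma eb_closed_ray n (Phi Theta : maps n) (u : nat -> R) l :
  eb Phi -> eb Theta -> (forall j, 0 <= u j) ->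
  (forall j, l - j.+1%:R^-1 < u j <= l) ->
  (forall j, eb (Theta - (u j)%:C%C *: Phi)) -> eb (Theta - l%:C%C *: Phi).
Proof.
move=> ePhi eT u0 ul eu k X pX.
have [U [ultraU /(_ u l ul) Ul]] := ultrafilter_nat.
rewrite ampliationB.
have sepT := eT _ _ pX; have sepP := ePhi _ _ pX.
have sepu j : separable (ampliation Theta X - (u j)%:C%C *: ampliation Phi X).
  by rewrite -ampliationB; apply: eu.
move: (ampliation Theta X) (ampliation Phi X) sepT sepP sepu => A B sA sB su.
apply: (separable_closed (c := \tr A) ultraU su) => [j|a b].
  rewrite raddfB /= gerBl mxtraceZ mulr_ge0 ?ler0c //.
  by apply: psdmx_trace_ge0; apply: separable_psd.
have E v : (A - v *: B) a b = A a b + - v * B a b by rewrite !mxE mulNr.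
rewrite E; apply: (tends_dominated ultraU ltr01
  (z := fun j => A a b + - (u j)%:C%C * B a b)).
  by move=> j; rewrite mul1r E.
apply: tendsD => //; first exact: tends_eq.
apply: tendsM => //; last exact: tends_eq.
by apply: (tends_dominated ultraU ltr01 _ Ul) => j; rewrite mul1r -opprD normrN.
Qed.

(** The trace at the identity bounds the multiples that can be subtracted. *)
Lemma complex_max_multiple : max_multiple S.
Proof.
move=> n Phi Theta ePhi Phi0 eT.
suff [u [u0 eu umax]] : exists u : R, [/\ 0 <= u, eb (Theta - u%:C%C *: Phi) &
    forall e : R, 0 < e -> ~ eb (Theta - (u + e)%:C%C *: Phi)].
  exists u%:C%C; split=> [||e e0]; [by rewrite ler0c | exact: eu |].
  have eR : e = (complex.Re e)%:C%C by rewrite RRe_real // gtr0_real.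
  by rewrite eR -rmorphD; apply: umax; rewrite -ltcR -eR.
pose A : set R := [set u | 0 <= u /\ eb (Theta - u%:C%C *: Phi)]%classic.
have trP := eb_trace_gt0 hS ePhi Phi0.
have trT := eb_trace_ge0 hS eT.
have ubA : ubound A (complex.Re (\tr (Theta one) / \tr (Phi one))).
  move=> u [u0 /(eb_trace_ge0 hS)]; rewrite add_lfunE opp_lfunE scale_lfunE.
  rewrite raddfB /= mxtraceZ subr_ge0 -ler_pdivlMr // -lecR RRe_real //.
  by rewrite ger0_real // divr_ge0 // ltW.
have A0 : A 0 by split=> //; rewrite rmorph0 scale0r subr0.
have sA : has_sup A by split; [exists 0 | eexists; apply: ubA].
have /choice[u Hu] : forall j : nat, exists u,
    A u /\ sup A - j.+1%:R^-1 < u <= sup A.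
  move=> j; have [|u Au lu] := @sup_adherent _ A (j.+1%:R^-1) _ sA.
    by rewrite invr_gt0 ltr0n.
  by exists u; split=> //; rewrite lu /=; apply: (sup_upper_bound sA).
have s0 : 0 <= sup A by apply: (sup_upper_bound sA).
exists (sup A); split=> //.
- by apply: (@eb_closed_ray _ _ _ u) => // j; have [[? ?] ?] := Hu j.
- move=> e e0 He; have : A (sup A + e).
    by split=> //; rewrite addr_ge0 // ltW.
  by move=> /(sup_upper_bound sA); rewrite gerDl leNgt e0.
Qed.

End MaxMultiple.

Section Minkowski.
Variables (C : numClosedFieldType) (d : nat) (S : {vspace 'M[C]_d}).
Hypotheses (hS : operator_system S) (hmax : max_multiple S).
Local Notation maps n := 'Hom(subvs_of S, 'M[C]_n).
Local Notation eb := entanglement_breaking.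
Local Notation one := (oneS S).

(** Membership of [Theta] in the face of the cone generated by [Phi]. *)
Definition below n (Phi Theta : maps n) :=
  eb Theta /\ exists2 c : C, 0 <= c & eb (c *: Phi - Theta).

(** A bound on the dimension of the face of the cone generated by [Phi]. *)
Definition face_rank_le n N (Phi : maps n) := forall X : seq (maps n),
  free X -> (forall Theta, Theta \in X -> below Phi Theta) -> (size X <= N)%N.

Lemma below_trans n (Phi Psi Theta : maps n) :
  below Phi Psi -> below Psi Theta -> below Phi Theta.
Proof.
move=> [ePsi [c c0 ec]] [eT [k k0 ek]]; split=> //; exists (k * c).
  exact: mulr_ge0.
have -> : (k * c) *: Phi - Theta =
    k *: (c *: Phi - Psi) + (k *: Psi - Theta).
  by rewrite scalerBr scalerA addrA subrK.
by apply: ebD => //; apply: ebZ.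
Qed.

(** All these maps commute with the adjoint, so the coordinates agree with
    their conjugates. *)
Lemma eb_real_coord n (X : seq (maps n)) (Phi : maps n) :
  free X -> (forall Theta, Theta \in X -> eb Theta) -> eb Phi ->
  Phi \in <<X>>%VS -> exists2 r : 'I_(size X) -> C,
  (forall i, r i \is Num.real) & Phi = \sum_i r i *: X`_i.
Proof.
move=> fX eX ePhi XPhi.
have defPhi := coord_span (X := in_tuple X) XPhi.
set c := fun i => coord (in_tuple X) i Phi.
have cc i : (c i)^* = c i.
  rewrite /c -[in RHS](_ : \sum_i (c i)^* *: X`_i = Phi).
    by rewrite (coord_sum_free (X := in_tuple X)).
  apply/lfunP => x; rewrite -[x in RHS](_ : adjS (adjS x) = x); last first.
    by apply: val_inj; rewrite /= !vsval_adjS // trmxCK.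
  rewrite (eb_adj hS) // [in RHS]defPhi !sum_lfunE adjmx_sum.
  apply: eq_bigr => j _.
  rewrite !scale_lfunE adjmxZ -(eb_adj hS); last by apply: eX; rewrite mem_nth.
  congr (_ *: X`_j _).
  by apply: val_inj; rewrite /= !vsval_adjS // trmxCK.
by exists c => // i; rewrite CrealE cc.
Qed.

Lemma below_span n (X : seq (maps n)) (Phi Psi : maps n) :
  free X -> (forall Theta, Theta \in X -> below Psi Theta) -> eb Phi ->
  Phi \in <<X>>%VS -> below Psi Phi.
Proof.
move=> fX bX ePhi XPhi; split=> //.
have [|r rR defPhi] := eb_real_coord fX _ ePhi XPhi.
  by move=> Theta /bX[].
have bXi (i : 'I_(size X)) : below Psi X`_i by apply: bX; rewrite mem_nth.
have /choice[c Hc] : forall i : 'I_(size X), exists c : C,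
    0 <= c /\ eb (c *: Psi - X`_i).
  by move=> i; have [_ [c c0 ec]] := bXi i; exists c.
exists (\sum_i `|r i| * c i).
  by apply: sumr_ge0 => i _; rewrite mulr_ge0 //; case: (Hc i).
rewrite defPhi scaler_suml -sumrB; apply: eb_sum => i _ /=.
have [c0 ec] := Hc i; have [eX _] := bXi i.
have [r0|r0] := real_ge0P (rR i).
  by rewrite -scalerA -scalerBr; apply: ebZ.
rewrite -scalerA -[X in _ - X]opprK opprK -scaleNr -scalerDr.
apply: ebZ; first by rewrite oppr_ge0 ltW.
have -> : c i *: Psi + X`_i = c i *: Psi - X`_i + (2 : C) *: X`_i.
  by rewrite scaler_nat mulr2n addrA subrK.
by apply: ebD => //; apply: ebZ.
Qed.

(** [Phi] is not in the span of the face of [Theta - u *: Phi], for otherwise a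
    little more of [Phi] could be subtracted. So a free family in this face
    stays free in the face of [Phi] when [Phi] is added to it. *)
Lemma face_rank_boundary n N (Phi Theta : maps n) (u : C) :
  eb Phi -> Phi != 0 -> below Phi Theta -> 0 <= u ->
  eb (Theta - u *: Phi) ->
  (forall e : C, 0 < e -> ~ eb (Theta - (u + e) *: Phi)) ->
  face_rank_le N.+1 Phi -> face_rank_le N (Theta - u *: Phi).
Proof.
move=> ePhi Phi0 bT u0 e1 umax rPhi X fX bX.
set Phi1 := Theta - _ in e1 bX.
have b1 : below Phi Phi1.
  apply: below_trans bT _; split=> //; exists 1 => //.
  rewrite scale1r /Phi1 opprB addrC subrK.
  exact: ebZ.
suff Phi_notin : Phi \notin <<X>>%VS.
  have := rPhi (Phi :: X); rewrite free_cons Phi_notin fX => /(_ isT); apply.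
  move=> Psi; rewrite inE => /orP[/eqP->|/bX]; last exact: below_trans.
  split=> //; exists 1 => //; rewrite scale1r subrr; exact: eb0.
apply/negP => /(below_span fX bX ePhi)[_ [c c0 ec]].
have c1 : 0 < c + 1 by rewrite ltr_wpDl.
apply: (umax (c + 1)^-1); first by rewrite invr_gt0.
have -> : Theta - (u + (c + 1)^-1) *: Phi =
    (c + 1)^-1 *: (c *: Phi1 - Phi + Phi1).
  rewrite addrAC -[X in _ + X - _]scale1r -scalerDl scalerBr scalerA.
  by rewrite mulVf ?gt_eqF // scale1r scalerDl opprD addrA.
by apply: ebZ; [rewrite invr_ge0 ltW | apply: ebD].
Qed.

(** Minkowski's theorem for the cone. If [Theta] is a summand of [Phi] but not
    a multiple of it, subtract from [Theta] and from [Phi - Theta] as much of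
    [Phi] as possible. The two remainders generate smaller faces, and they add
    up to a positive multiple of [Phi]. *)
Lemma eb_sum_pure n (Phi : maps n) : eb Phi ->
  exists2 s : seq (maps n), (forall phi, phi \in s -> pure phi) &
    Phi = \sum_(phi <- s) phi.
Proof.
have [N rN] : exists N, face_rank_le N Phi.
  exists (\dim {: maps n}) => X fX _.
  by move: fX => /eqP <-; apply: dimvS; apply: subvf.
elim: N Phi rN => [|N IH] Phi rN ePhi; have [->|Phi0] := eqVneq Phi 0;
    try by exists [::]; rewrite ?big_nil.
  suff : (size [:: Phi] <= 0)%N by [].
  apply: rN; rewrite ?seq1_free // => Theta.
  rewrite inE => /eqP ->; split=> //; exists 1 => //.
  by rewrite scale1r subrr; apply: eb0.
have [pPhi|] := pselect (pure Phi).
  by exists [:: Phi]; rewrite ?big_seq1 // => phi; rewrite inE => /eqP ->.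
move=> npure.
have [Theta [eT [eB nT]]] : exists Theta,
    eb Theta /\ eb (Phi - Theta) /\ forall c, Theta <> c *: Phi.
  apply: contrapT => H; apply: npure; split=> // Theta eT eB.
  apply: contrapT => nc; apply: H; exists Theta; do 2!split=> //.
  by move=> c Tc; apply: nc; exists c.
have bT : below Phi Theta by split=> //; exists 1; rewrite // scale1r.
have bB : below Phi (Phi - Theta).
  by split=> //; exists 1; rewrite // scale1r opprB addrC subrK.
have [u [u0 eu umax]] := hmax ePhi Phi0 eT.
have [w [w0 ew wmax]] := hmax ePhi Phi0 eB.
have [s ps es] := IH _ (face_rank_boundary ePhi Phi0 bT u0 eu umax rN) eu.
have [t pt et] := IH _ (face_rank_boundary ePhi Phi0 bB w0 ew wmax rN) ew.
have defPhi : (1 - u - w) *: Phi =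
    \sum_(phi <- s) phi + \sum_(phi <- t) phi.
  rewrite -es -et !scalerBl scale1r.
  by rewrite addrACA [Theta + _]addrC subrK -addrA.
have k0 : 0 < 1 - u - w.
  have trP := eb_trace_gt0 hS ePhi Phi0.
  have tr1 := eb_trace_ge0 hS eu; have tr2 := eb_trace_ge0 hS ew.
  have /(congr1 (fun f : maps n => \tr (f one))) := defPhi.
  rewrite -es -et add_lfunE scale_lfunE mxtraceZ raddfD /= => trE.
  rewrite lt0r -(pmulr_lge0 _ trP) trE addr_ge0 // andbT.
  apply/eqP => k0; move: trE; rewrite k0 mul0r => /esym/eqP.
  rewrite paddr_eq0 // => /andP[/eqP/(eb_eq0 hS eu)/eqP]; rewrite subr_eq0.
  by move/eqP => /nT.
exists [seq (1 - u - w)^-1 *: phi | phi <- s ++ t].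
  move=> phi /mapP[psi]; rewrite mem_cat => Hpsi ->.
  apply: pureZ; first by rewrite invr_gt0.
  by case/orP: Hpsi; [apply: ps | apply: pt].
rewrite big_map -scaler_sumr big_cat /= -defPhi scalerA.
by rewrite mulVf ?gt_eqF // scale1r.
Qed.

End Minkowski.

(** * Pure maps are compressions of C*-extreme points *)

Section Extremes.
Variables (C : numClosedFieldType) (d : nat) (S : {vspace 'M[C]_d}).
Hypotheses (hS : operator_system S) (hmax : max_multiple S).
Local Notation maps n := 'Hom(subvs_of S, 'M[C]_n).
Local Notation eb := entanglement_breaking.
Local Notation one := (oneS S).

Lemma eb_sub_summand n (s : seq (maps n)) (Theta : maps n) :
  (forall Psi, Psi \in s -> eb Psi) -> Theta \in s ->
  eb (\sum_(Psi <- s) Psi - Theta).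
Proof.
move=> es Ts; rewrite (big_rem _ Ts) /= addrAC subrr add0r big_seq.
by apply: eb_sum => Psi /mem_rem; apply: es.
Qed.

(** One column of a nonzero off-diagonal corner is nonzero, so the failure of
    maximality is already visible in dimension [m + 1]. *)
Lemma nonmaximal_corner m (phi : maps m) : ~ maximal phi ->
  exists (Omega : maps (m + 1)) X, [/\ eb Omega, compress inlmx Omega = phi,
    inlmx^t* *m Omega one *m inrmx = 0 &
    inlmx^t* *m Omega X *m inrmx <> 0].
Proof.
move=> nmax; apply: contrapT => H; apply: nmax => r Omega eO Ophi O1 X.
apply/matrixP => i j; rewrite [RHS]mxE; apply: contrapT => Oij.
pose V : 'M[C]_(m + r, m + 1) := row_mx inlmx (inrmx *m delta_mx j 0).
have corner Y : inlmx^t* *m compress V Omega Y *m inrmx =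
    inlmx^t* *m Omega Y *m inrmx *m delta_mx j 0.
  by rewrite compressE !mulmxA -adjmxM row_mx_inl -mulmxA row_mx_inr mulmxA.
apply: H; exists (compress V Omega), X; split; first exact: eb_compress.
- by rewrite compressM row_mx_inl.
- by rewrite corner O1 mul0mx.
- by rewrite corner -colE => /matrixP/(_ i 0); rewrite mxE [RHS]mxE.
Qed.

(** Decompose a dilation of [phi] that is not a direct sum into pure maps. If
    elimination cleared the off-diagonal corners of all of them, the dilation
    would be a direct sum; so one of them keeps a nonzero corner, hence nonzero
    diagonal corners, and it can be rescaled to a unital dilation of [phi]. *)
Lemma pure_dilation m (phi : maps m) :
  pure phi -> unital phi -> ~ maximal phi ->
  exists2 psi : maps (m + 1), pure psi /\ unital psi & compress inlmx psi = phi.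
Proof.
move=> pphi uphi /nonmaximal_corner[Omega [X [eO Ophi O1 OX]]].
have [ephi phi0 rphi] := pphi.
have [s ps defO] := eb_sum_pure hS hmax eO.
(* The inequality says that the corner at [X] survives the elimination. *)
have [Theta [Ts TX]] : exists Theta : maps (m + 1), Theta \in s /\
    inlmx^t* *m Theta X *m inrmx <> phi X *m (inlmx^t* *m Theta one *m inrmx).
  apply: contrapT => H; apply: OX.
  have -> : inlmx^t* *m Omega X *m inrmx =
      phi X *m (inlmx^t* *m Omega one *m inrmx).
    rewrite defO !sum_lfunE !mulmx_sumr !mulmx_suml mulmx_sumr.
    rewrite !big_seq; apply: eq_bigr => Theta Ts; apply: contrapT => TX.
    by apply: H; exists Theta.
  by rewrite O1 mulmx0.
have pT := ps _ Ts; have [eT _ _] := pT.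
have eB : eb (Omega - Theta).
  by rewrite defO; apply: eb_sub_summand => // Psi /ps[].
have [||c Tc] := rphi (compress inlmx Theta); first exact: eb_compress.
  by rewrite -Ophi -compressN -compressD; apply: eb_compress.
have c0 : 0 < c.
  rewrite lt0r; apply/andP; split; last first.
    by apply: (eb_coef_ge0 hS ephi phi0); rewrite -Tc; apply: eb_compress.
  apply/eqP => c0; move: Tc; rewrite c0 scale0r => Tc; apply: TX.
  have := congr1 (fun f : maps m => f one) Tc; rewrite compressE lfunE /= => T0.
  by rewrite !(eb_kerl hS eT T0) !mul0mx mulmx0.
have /= := clear_corner hS uphi c0 Tc.
set g := _ *: (_ *m _); set w := _ - _ => -[w0 wphi].
have Tw : inlmx^t* *m Theta X *m w <> 0.
  rewrite mulmxBr => /eqP; rewrite subr_eq0 => /eqP E; apply: TX; rewrite E.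
  have := congr1 (fun f : maps m => f X) Tc.
  rewrite mulmxA compressE scale_lfunE => ->.
  by rewrite -scalemxAl -scalemxAr scalerA mulfV ?gt_eqF // scale1r.
pose k := (w^t* *m Theta one *m w) 0 0.
have defk : w^t* *m Theta one *m w = k%:M by apply: mx11_scalar.
have k0 : 0 < k.
  rewrite lt0r; apply/andP; split; last first.
    by have := psdmx_conj w (eb_one_psd hS eT) => /psdmx_diag_ge0; apply.
  apply/eqP => k0; apply: Tw; rewrite -mulmxA (eb_ker hS eT) ?mulmx0 //.
  by rewrite defk k0 raddf0.
pose a := (sqrtC c)^-1 *: (@inlmx C m 1); pose b := (sqrtC k)^-1 *: w.
pose psi := compress (row_mx a b) Theta.
have upsi : psi one = 1%:M.
  have ab : a^t* *m Theta one *m b = 0.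
    by rewrite adjmxZ -!scalemxAl -scalemxAr w0 !scaler0.
  have ba : b^t* *m Theta one *m a = 0.
    by rewrite -[LHS]trmxCK adjmx_quad (psdmx_adj (eb_one_psd hS eT)) ab adjmx0.
  have aa : a^t* *m Theta one *m a = 1%:M.
    by rewrite -compressE wphi; apply/unitalE.
  have bb : b^t* *m Theta one *m b = 1%:M.
    rewrite adjmxZ -!scalemxAl -scalemxAr defk scalerA scale_scalar_mx.
    rewrite conj_Creal ?realV ?ger0_real ?sqrtC_ge0 ?ltW //.
    by rewrite -invfM -expr2 sqrtCK mulVf ?gt_eqF.
  rewrite compressE tr_row_mx map_col_mx mul_col_mx mul_col_mx !mul_mx_row.
  by rewrite aa ab ba bb -block_mxEv -scalar_mx_block.
have uQ : row_mx a b \in unitmx.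
  by move: upsi; rewrite compressE => /mulmx1_unit[].
exists psi; last by rewrite compressM row_mx_inl.
by split; [apply: pure_compress | apply/unitalE].
Qed.

Lemma pure_state m (phi : maps m) : pure phi -> unital phi ->
  exists2 s : maps 1, pure s & unital s.
Proof.
move=> pphi /(unitalE hS) u1; have m0 := pure_dim_gt0 pphi.
have [ephi _ _] := pphi.
pose v : 'cV[C]_m := delta_mx (Ordinal m0) 0.
have [s ps defs] := eb_sum_pure hS hmax (eb_compress v ephi).
case: s => [|f s] in ps defs *.
  have /matrixP/(_ 0 0) := congr1 (fun f : maps 1 => f one) defs.
  rewrite big_nil compressE u1 quad_delta lfunE /= !mxE !eqxx => /eqP.
  by rewrite oner_eq0.
have [r [g [phi' [r1 p' u' _]]]] := pure_normalize hS (ps f (mem_head _ _)).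
have r0 := pure_dim_gt0 p'.
have er : r = 1%N by apply/eqP; rewrite eqn_leq r1.
by case: _ / er in phi' p' u' *; exists phi'.
Qed.

(** Dilate until the dimension is [n] or the pure map is maximal; in the latter
    case add a direct summand, itself obtained from a pure state. *)
Lemma pure_compress_cext n m (phi : maps m) : pure phi -> unital phi ->
  (m <= n)%N -> exists (V : 'M_(n, m)) (Psi : maps n),
  cext Psi /\ phi = compress V Psi.
Proof.
elim/ltn_ind: n m phi => n IHn m phi.
have [k] := ubnP (n - m); elim: k m phi => // k IHk m phi lek pphi uphi.
rewrite leq_eqVlt => /predU1P[en|lt_mn].
  case: _ / en; exists 1%:M, phi.
  by rewrite compress1; split=> //; apply: pure_cext.
have [mphi|] := pselect (maximal phi); last first.
  move=> /(pure_dilation pphi uphi)[psi [ppsi upsi] <-].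
  have [||V [Psi [xPsi ->]]] := IHk _ psi _ ppsi upsi.
  - by rewrite addn1 subnS prednK ?subn_gt0.
  - by rewrite addn1.
  by exists (V *m inlmx), Psi; rewrite compressM.
have [s ps us] := pure_state pphi uphi.
have [||V [psi [xpsi _]]] := IHn (n - m)%N _ _ s ps us.
- by rewrite ltn_subrL (pure_dim_gt0 pphi) (leq_ltn_trans _ lt_mn).
- by rewrite subn_gt0.
have en : n = (m + (n - m))%N by rewrite subnKC // ltnW.
move: psi xpsi {V IHn IHk lek lt_mn}; move: en.
move: (n - m)%N => r -> psi xpsi.
exists inlmx, (dsum phi psi); rewrite compress_dsum_inl; split=> //.
exact: cext_dsum.
Qed.

Lemma UEB_hull n : UEB S n = cstar_hull (cstar_extreme S n).
Proof.
apply/seteqP; split=> Phi; last first.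
  move=> [k [T [Psi [xPsi [sT defPhi]]]]]; split.
    apply/(unitalE hS); rewrite defPhi -sT; apply: eq_bigr => i _.
    by have [[/(unitalE hS) -> _] _] := xPsi i; rewrite mulmx1.
  have -> : Phi = \sum_i compress (T i) (Psi i).
    apply/lfunP => X; rewrite defPhi sum_lfunE; apply: eq_bigr => i _.
    by rewrite compressE.
  by apply: eb_sum => i _; apply: eb_compress; have [[_ ?] _] := xPsi i.
move=> [/(unitalE hS) uPhi ePhi].
have [s ps defPhi] := eb_sum_pure hS hmax ePhi.
have /choice[p Hp] : forall i : 'I_(size s), exists p : _ * _,
    cstar_extreme S n p.2 /\ s`_i = compress p.1 p.2.
  move=> i; have := ps s`_i; rewrite mem_nth // => /(_ isT) pi.
  have [r [g [phi [lern pphi uphi ->]]]] := pure_normalize hS pi.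
  have [V [Psi [xPsi ->]]] := pure_compress_cext pphi uphi lern.
  exists (V *m g, Psi); rewrite compressM; split=> //.
  exact: cext_extreme.
have PhiE X : Phi X = \sum_i (p i).1^t* *m (p i).2 X *m (p i).1.
  rewrite defPhi (big_nth 0) big_mkord sum_lfunE; apply: eq_bigr => i _.
  by have [_ ->] := Hp i; rewrite compressE.
exists (size s), (fun i => (p i).1), (fun i => (p i).2); split.
  by move=> i; have [] := Hp i.
split=> //; rewrite -uPhi PhiE; apply: eq_bigr => i _.
by have [[[/(unitalE hS) -> _] _] _] := Hp i; rewrite mulmx1.
Qed.

End Extremes.

Theorem corollary1p15 (R : realType) (d n : nat)
    (S : {vspace 'M[R[i]]_d}) (hS : operator_system S) :
  UEB S n = cstar_hull (cstar_extreme S n).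
Proof. exact: (UEB_hull hS (complex_max_multiple hS)). Qed.
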